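(* Let $G$ be a finite connected simple graph. The connected subgraph arrangement $\mathcal{A}_G$ is factored if and only if $G$ is a path graph or is isomorphic to a path-with-triangle graph $\Delta_{n,1}$ for some $n\ge 2$.
   Context: For a finite simple graph $G=(N,E)$ with $N=\{1,\dots,n\}$ and $I\subseteq N$, $G[I]$ denotes the induced subgraph on $I$, and $H_I=\ker\big(\sum_{i\in I}x_i\big)$, where $x_1,\dots,x_n$ are the coordinate functions. The connected subgraph arrangement of $G$ is $\mathcal{A}_G=\{H_I:\emptyset\neq I\subseteq N,\ G[I]\text{ connected}\}$ over $\mathbb{Q}$. The path graph $P_m$ has vertices $1,\dots,m$ and edges $\{i,i+1\}$. $\Delta_{n,1}$ has vertices $1,\dots,n+1$ and edges $\{i,i+1\}$ ($1\le i<n$), $\{1,n+1\}$, $\{2,n+1\}$ (so $\Delta_{2,1}$ is a triangle). A partition $\pi=(\pi_1,\dots,\pi_s)$ of an arrangement $\mathcal{A}$ is nice if (i) for every choice $H_i\in\pi_i$ the $s$ defining forms are linearly independent, and (ii) for every $X\in L(\mathcal{A})\setminus\{V\}$ the induced partition of $\mathcal{A}_X=\{H\in\mathcal{A}:X\subseteq H\}$ into the nonempty sets $\pi_i\cap\mathcal{A}_X$ has a singleton block. $\mathcal{A}$ is factored if it admits a nice partition. *)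

(* Defs.v *)
From HB Require Import structures.
From mathcomp Require Import all_boot all_order all_algebra.
From mathcomp Require Import vector.
Set Implicit Arguments. Unset Strict Implicit. Unset Printing Implicit Defensive.
Import Order.TTheory GRing.Theory Num.Theory.

(* Vertices of G are 'I_n (0-indexed version of {1,...,n});
   a simple graph is a symmetric irreflexive relation e on 'I_n. *)

Definition induced_connected (n : nat) (e : rel 'I_n) (I : {set 'I_n}) : bool :=
  (I != set0) &&
  [forall x in I, forall y in I,
     connect (fun a b => [&& a \in I, b \in I & e a b]) x y].

Definition connected_graph (n : nat) (e : rel 'I_n) : bool :=
  induced_connected e [set: 'I_n].

(* the defining linear form sum_{i in I} x_i, as a row vector over Q *)
Definition form (n : nat) (I : {set 'I_n}) : 'rV[rat]_n :=
  \row_(j < n) ((j \in I)%:R : rat).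

(* H_I = ker(sum_{i in I} x_i) as a subspace of V = Q^n (row space of a matrix) *)
Definition hyp (n : nat) (I : {set 'I_n}) : 'M[rat]_n :=
  kermx (form I)^T.

(* The connected subgraph arrangement, indexed by the vertex sets I
   (distinct I give distinct hyperplanes H_I). *)
Definition CSA (n : nat) (e : rel 'I_n) : {set {set 'I_n}} :=
  [set I | induced_connected e I].

Definition flat (n : nat) (B : {set {set 'I_n}}) : 'M[rat]_n :=
  (\bigcap_(I in B) hyp I)%MS.

Definition nice_partition (n : nat) (A : {set {set 'I_n}})
    (P : {set {set {set 'I_n}}}) : Prop :=
  [/\ partition P A,
   (forall f : {set {set 'I_n}} -> {set 'I_n},
      (forall C, C \in P -> f C \in C) ->
      free [seq form (f C) | C <- enum P]) &
   (* (ii) for X = intersection of B in L(A), X <> V, the induced partition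
      of A_X = {H_I in A : X <= H_I} has a singleton block *)
   (forall B : {set {set 'I_n}}, B \subset A ->
      ~~ ((1%:M)%R <= flat B)%MS ->
      exists2 C, C \in P & #|[set I in C | (flat B <= hyp I)%MS]| = 1%N)].

Definition factored (n : nat) (A : {set {set 'I_n}}) : Prop :=
  exists P : {set {set {set 'I_n}}}, nice_partition A P.

Definition graph_iso (n : nat) (e r : rel 'I_n) : Prop :=
  exists f : 'I_n -> 'I_n, bijective f /\ forall x y, e x y = r (f x) (f y).

Definition path_rel (n : nat) : rel 'I_n :=
  fun x y => (x.+1 == y :> nat) || (y.+1 == x :> nat).

(* Delta_{k,1} with k = n - 1 (n = k+1 vertices), 0-indexed:
   vertices 0..k, edges {i,i+1} for i < k-1, {0,k}, {1,k} *)
Definition delta_edge (k i j : nat) : bool :=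
  ((i.+1 == j) && (j < k)) || ((i == 0) && (j == k)) || ((i == 1) && (j == k)).

Definition delta_rel (n : nat) : rel 'I_n :=
  fun x y => delta_edge n.-1 x y || delta_edge n.-1 y x.

(* Main.v *)
(** A nice partition colours the connected sets by its blocks, and flats of rank
    two constrain this colouring: two sets I, J get different colours unless they
    are disjoint or nested with connected symmetric difference K, in which case
    exactly two of I, J, K share a colour.  Colourings pass to induced minors, and
    a search shows that the claw, the 4-cycle, the diamond, K4, the bull and the
    bowtie have none; growing an induced subgraph one vertex at a time, only
    paths and paths with a triangle survive.

    Conversely, writing p_j for the sum of the first j coordinates along the path
    and b for the coordinate of the apex, every form is p_j - p_i or b + p_j - p_i.
    Group these by j, except that b and all p_j form one block; the singleton
    block over a flat is then found at a minimal j. *)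

Require Import Defs.
From HB Require Import structures.
From mathcomp Require Import all_boot all_order all_algebra.
From mathcomp Require Import zify lra.
Set Implicit Arguments. Unset Strict Implicit. Unset Printing Implicit Defensive.
Import GRing.Theory Num.Theory Defs.

(** * Connected vertex sets *)

(** Rank two is enough to exclude graphs because the intersection of two hyperplanes of the
    arrangement lies in at most one further one, given by a disjoint union or a nested difference.
    The resulting condition is purely set-theoretic, survives pulling vertex sets back along branch
    sets, and is finite for a fixed minor. Induced subgraphs alone would not do: the neighbours of
    an added vertex may be far apart on the path, and two triangles may sit at the ends of a long
    path. Contracting the stretch between them leaves a graph on four or five vertices. For the
    converse all flats count. Independence of every transversal becomes a question about common
    zeros: with at most n blocks, it suffices that a vector annihilated by one form of each block is
    zero. *)

(** The set of vertices reachable from a point of [I] has no edge leaving it within [I]. The cut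
    form avoids paths: it is what [mask_conn] evaluates on bitmasks, and it passes easily to unions
    and quotients. *)
Lemma induced_connected_cutP n (e : rel 'I_n) (I : {set 'I_n}) : symmetric e ->
  reflect (I != set0 /\ forall S : {set 'I_n}, S \subset I -> S != set0 -> S != I ->
             exists x y, [/\ x \in S, y \in I :\: S & e x y])
          (induced_connected e I).
Proof.
move=> e_sym; apply: (iffP andP) => -[I0 conI]; split=> //.
  move=> S SI S0 SneI; have /set0Pn [x xS] := S0.
  have /subsetPn [y yI yS] : ~~ (I \subset S).
    by apply: contra SneI => IS; rewrite eqEsubset SI.
  have /connectP [p] := implyP (forallP (implyP (forallP conI x)
                                   (subsetP SI x xS)) y) yI.
  elim: p x xS => [|z p IHp] x xS /= => [_ yx|/andP [/and3P [xI zI exz] pz] lz].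
    by rewrite yx xS in yS.
  have [zS|zS] := boolP (z \in S); first exact: IHp pz lz.
  by exists x, z; rewrite inE zS zI.
apply/forall_inP => x xI; apply/forall_inP => y yI.
set r := (fun _ _ => _).
pose S := [set z in I | connect r x z].
have xS : x \in S by rewrite inE xI connect0.
have [/eqP SI|SneI] := boolP (S == I); first by move: yI; rewrite -SI inE => /andP[].
have SI : S \subset I by apply/subsetP=> z; rewrite inE => /andP[].
have [|z [t []]] := conI S SI _ SneI; first by apply/set0Pn; exists x.
rewrite !inE => /andP [zI xz] /andP [tS tI] ezt.
case/negP: tS; rewrite tI; apply: connect_trans xz (connect1 _).
by rewrite /r zI tI ezt.
Qed.

Lemma induced_connected1 n (e : rel 'I_n) x : induced_connected e [set x].
Proof.
apply/andP; split; first by apply/set0Pn; exists x; rewrite set11.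
apply/forall_inP => y /set1P ->; apply/forall_inP => z /set1P ->.
exact: connect0.
Qed.

(** A cut of the union that splits neither [I] nor [J] separates the two, so [x] and [y] are
    distinct and the edge between them crosses the cut. *)
Lemma induced_connectedU n (e : rel 'I_n) (I J : {set 'I_n}) x y : symmetric e ->
  induced_connected e I -> induced_connected e J ->
  x \in I -> y \in J -> (x == y) || e x y -> induced_connected e (I :|: J).
Proof.
move=> e_sym /(induced_connected_cutP _ e_sym) [I0 cutI].
move=> /(induced_connected_cutP _ e_sym) [J0 cutJ] xI yJ exy.
apply/(induced_connected_cutP _ e_sym); split=> [|S SIJ S0 SneIJ].
  by apply/set0Pn; exists x; rewrite inE xI.
have inside (K : {set 'I_n}) : K \subset I :|: J ->
    (forall S : {set 'I_n}, S \subset K -> S != set0 -> S != K ->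
             exists x y, [/\ x \in S, y \in K :\: S & e x y]) ->
    [\/ S :&: K = set0, K \subset S |
      exists x y, [/\ x \in S, y \in (I :|: J) :\: S & e x y]].
  move=> KIJ cutK.
  have [->|SK0] := eqVneq (S :&: K) set0; first by constructor 1.
  have [/setIidPr SK|SKK] := eqVneq (S :&: K) K; first by constructor 2.
  have [z [t [/setIP [zS _]]]] := cutK _ (subsetIr _ _) SK0 SKK.
  rewrite !inE => /andP [tS tK] ezt; constructor 3; exists z, t.
  have := subsetP KIJ t tK; rewrite !inE => ->.
  by move: tS; rewrite tK andbT => ->.
have [SI|IS|//] := inside I (subsetUl _ _) cutI;
  have [SJ|JS|//] := inside J (subsetUr _ _) cutJ.
- case/negP: S0; rewrite -subset0; apply/subsetP => z zS.
  have /setUP [zI|zJ] := subsetP SIJ z zS.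
    by rewrite -SI inE zS.
  by rewrite -SJ inE zS.
- have xS : x \notin S by apply/negP => xS; have := in_set0 x; rewrite -SI inE xS xI.
  have yS := subsetP JS y yJ.
  have /negPf xy : x != y by apply: contraNneq xS => ->.
  rewrite xy /= in exy.
  by exists y, x; rewrite !inE xS xI e_sym.
- have yS : y \notin S by apply/negP => yS; have := in_set0 y; rewrite -SJ inE yS yJ.
  have xS := subsetP IS x xI.
  have /negPf xy : x != y by apply: contraNneq yS => <-.
  rewrite xy /= in exy.
  by exists x, y; rewrite !inE yS yJ orbT.
- by case/negP: SneIJ; rewrite eqEsubset SIJ subUset IS.
Qed.

(** * Flats as common zeros of coordinate sums *)

Local Open Scope ring_scope.

Definition coord_sum n (u : 'rV[rat]_n) (I : {set 'I_n}) : rat :=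
  \sum_(i in I) u 0 i.

Lemma coord_sumE n (u : 'rV[rat]_n) I : coord_sum u I = (u *m (form I)^T) 0 0.
Proof.
rewrite !mxE /coord_sum big_mkcond /=.
by apply: eq_bigr => j _; rewrite !mxE; case: (j \in I); rewrite ?mulr1 ?mulr0.
Qed.

Lemma sub_hyp n (u : 'rV[rat]_n) I : (u <= hyp I)%MS = (coord_sum u I == 0).
Proof.
rewrite /hyp sub_kermx coord_sumE.
by apply/eqP/eqP => [->|u0]; [rewrite mxE|apply/rowP=> i; rewrite ord1 u0 mxE].
Qed.

Lemma sub_flat n (u : 'rV[rat]_n) B :
  (u <= flat B)%MS = [forall (I | I \in B), coord_sum u I == 0].
Proof.
rewrite /flat; apply/sub_bigcapmxP/forall_inP => uB I IB.
  by rewrite -sub_hyp uB.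
by rewrite sub_hyp uB.
Qed.

Lemma flat_sub_hypP n B (I : {set 'I_n}) :
  reflect (forall u, (u <= flat B)%MS -> coord_sum u I = 0) (flat B <= hyp I)%MS.
Proof.
apply: (iffP idP) => [BI u uB|BI].
  by apply/eqP; rewrite -sub_hyp (submx_trans uB BI).
by apply/row_subP => i; rewrite sub_hyp; apply/eqP/BI/row_sub.
Qed.

Lemma flat_sub n (B : {set {set 'I_n}}) I : I \in B -> (flat B <= hyp I)%MS.
Proof.
by move=> IB; apply/flat_sub_hypP => u; rewrite sub_flat => /forall_inP/(_ I IB)/eqP.
Qed.

(** Double annihilator: the columns of the cokernel of the matrix with rows [form I] and [form J]
    lie in the flat, so [form K] kills them and belongs to the row space. *)
Lemma flat2_sub_hyp n (I J K : {set 'I_n}) : (flat [set I; J] <= hyp K)%MS ->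
  exists a b : rat, form K = a *: form I + b *: form J.
Proof.
move=> /flat_sub_hypP flatK.
have coker u : (u *m (form K)^T) = 0 -> form K *m u^T = 0.
  by move=> /(congr1 trmx); rewrite trmx_mul trmx0 trmxK.
have: (form K <= col_mx (form I) (form J))%MS.
  rewrite submxE; apply/eqP/trmx_inj; rewrite trmx_mul trmx0.
  apply/row_matrixP => i; rewrite row_mul row0; set u := row i _.
  have uIJ : u *m (col_mx (form I) (form J))^T = 0.
    by rewrite -row_mul -trmx_mul mulmx_coker trmx0 row0.
  have [uI uJ] : u *m (form I)^T = 0 /\ u *m (form J)^T = 0.
    by move: uIJ; rewrite tr_col_mx mul_mx_row -row_mx0 => /eq_row_mx.
  apply/sub_kermxP; rewrite -/(hyp K) sub_hyp; apply/eqP/flatK.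
  rewrite sub_flat; apply/forall_inP => L /set2P [->|->]; rewrite -sub_hyp;
    exact/sub_kermxP.
case/submxP => D ->; exists (lsubmx D 0 0), (rsubmx D 0 0).
rewrite -[D in LHS]hsubmxK mul_row_col -!mul_scalar_mx -!mx11_scalar.
by [].
Qed.

(** Forms without a common nonzero zero have rank n, and at most n forms of rank n are
    independent. *)
Lemma free_of_forms n (s : seq {set 'I_n}) : (size s <= n)%N ->
  (forall u, (forall I, I \in s -> coord_sum u I = 0) -> u = 0) ->
  free [seq form J | J <- s].
Proof.
move=> sn kill.
pose M : 'M[rat]_(size s, n) := \matrix_i form (nth set0 s i).
have rankM : \rank M = n.
  rewrite -mxrank_tr; apply/eqP; rewrite -/(row_free _) -kermx_eq0.
  apply/eqP/row_matrixP => i; rewrite row0; apply: kill => I Is.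
  apply/eqP; rewrite -sub_hyp; apply/sub_kermxP.
  have iI : (index I s < size s)%N by rewrite index_mem.
  have /(congr1 trmx): row i (kermx M^T) *m M^T = 0 by apply/sub_kermxP/row_sub.
  rewrite trmx_mul trmxK trmx0 => /(congr1 (row (Ordinal iI))).
  rewrite row_mul rowK /= nth_index // row0 => /(congr1 trmx).
  by rewrite trmx_mul trmxK trmx0.
have freeM : row_free M.
  by rewrite /row_free eqn_leq rank_leq_row rankM.
apply/(@freeP _ _ _ (map_tuple (@form n) (in_tuple s))) => k k0 i.
have : (\row_i k i) *m M = 0.
  rewrite mulmx_sum_row -[RHS]k0; apply: eq_bigr => j _.
  by rewrite mxE rowK (nth_map set0).
rewrite -[RHS](mul0mx _ M) => /(row_free_inj freeM) /rowP /(_ i).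
by rewrite !mxE.
Qed.

(** * The constraints imposed by flats of rank two *)

Definition symdiff (T : finType) (I J : {set T}) : {set T} :=
  (I :\: J) :|: (J :\: I).

(* For nonempty distinct I, J, exactly when the coordinate vector of the
   symmetric difference lies in the span of those of I and J. *)
Definition laminar (T : finType) (I J : {set T}) : bool :=
  [|| [disjoint I & J], I \subset J | J \subset I].

Lemma form_symdiff n (I J : {set 'I_n}) : laminar I J ->
  exists a b : rat, form (symdiff I J) = a *: form I + b *: form J.
Proof.
case/or3P => [dIJ|IJ|JI]; [exists 1, 1|exists (-1), 1|exists 1, (-1)];
  apply/rowP => x; rewrite !mxE !inE.
- by have := disjointFr dIJ (x := x); case: (x \in I) => // [->|_]; case: (x \in J) => //.
- by have := subsetP IJ x; case: (x \in I) => [->|_] //; case: (x \in J).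
- by have := subsetP JI x; case: (x \in J) => [->|_] //; case: (x \in I).
Qed.

(** Write [form K] as a combination of [form I] and [form J] with coefficients a and b. All entries
    are 0 or 1, so when both coefficients are nonzero, a = 1 if [I] is not inside [J], b = 1 if [J]
    is not inside [I], and a + b is 0 or 1 if the sets meet. Crossing sets thus admit no such [K],
    disjoint ones only the union, nested ones only the difference. *)
Lemma flat2_sub_hypE n (I J K : {set 'I_n}) : I != J -> I != set0 -> J != set0 ->
  K != set0 -> (flat [set I; J] <= hyp K)%MS ->
  [\/ K = I, K = J | laminar I J /\ K = symdiff I J].
Proof.
move=> IneJ /set0Pn [i iI] /set0Pn [j jJ] /set0Pn [k kK] /flat2_sub_hyp [a [b Kab]].
have E x : (x \in K)%:R = a * (x \in I)%:R + b * (x \in J)%:R.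
  by have := congr1 (fun A : 'rV_n => A 0 x) Kab; rewrite !mxE.
have R x (y : bool) : (x = y%:R :> rat) -> x = 0 \/ x = 1.
  by case: y => ->; [right|left].
have a01 x : x \in I -> x \notin J -> a = 0 \/ a = 1.
  by have := E x; case: (x \in I) => //; case: (x \in J) => //;
    rewrite mulr1 mulr0 addr0 => /esym/R.
have b01 x : x \in J -> x \notin I -> b = 0 \/ b = 1.
  by have := E x; case: (x \in I) => //; case: (x \in J) => //;
    rewrite mulr1 mulr0 add0r => /esym/R.
have ab01 x : x \in J -> x \in I -> a + b = 0 \/ a + b = 1.
  by have := E x; case: (x \in I) => //; case: (x \in J) => //;
    rewrite !mulr1 => /esym/R.
have toK (L : {set 'I_n}) :
    (forall x, (x \in L)%:R = a * (x \in I)%:R + b * (x \in J)%:R) -> K = L.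
  move=> EL; apply/setP => x; have := EL x; rewrite -E.
  by case: (x \in L); case: (x \in K) => // /eqP; rewrite eqr_nat.
have [a0|a0] := eqVneq a 0.
  have [b0|b0] := eqVneq b 0.
    have /eqP := E k; rewrite kK a0 b0 !mul0r add0r; by rewrite (eqr_nat _ 1 0).
  have b1 : b = 1.
    have [jI|jI] := boolP (j \in I).
      case: (ab01 j jJ jI); rewrite a0 add0r => // /eqP; by rewrite (negPf b0).
    by case: (b01 j jJ jI) => // /eqP; rewrite (negPf b0).
  by constructor 2; apply: toK => x; rewrite a0 b1 mul0r mul1r add0r.
have [b0|b0] := eqVneq b 0.
  have a1 : a = 1.
    have [iJ|iJ] := boolP (i \in J).
      by case: (ab01 i iJ iI); rewrite b0 addr0 => // /eqP; rewrite (negPf a0).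
    by case: (a01 i iI iJ) => // /eqP; rewrite (negPf a0).
  by constructor 1; apply: toK => x; rewrite a1 b0 mul0r mul1r addr0.
have {}a01 x : x \in I -> x \notin J -> a = 1.
  by move=> xI xJ; case: (a01 x xI xJ) => // /eqP; rewrite (negPf a0).
have {}b01 x : x \in J -> x \notin I -> b = 1.
  by move=> xI xJ; case: (b01 x xI xJ) => // /eqP; rewrite (negPf b0).
constructor 3.
have [IJ|/subsetPn [x xI xJ]] := boolP (I \subset J).
  have [JI|/subsetPn [y yJ yI]] := boolP (J \subset I).
    by case/negP: IneJ; rewrite eqEsubset IJ.
  have b1 := b01 y yJ yI.
  have a1 : a = -1.
    have iJ := subsetP IJ i iI.
    case: (ab01 i iJ iI); rewrite b1; first by move/eqP; rewrite addr_eq0 => /eqP.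
    by move/(canRL (addrK _)); rewrite subrr => /eqP; rewrite (negPf a0).
  split; first by rewrite /laminar IJ orbT.
  apply: toK => z; rewrite !inE a1 b1; have := subsetP IJ z.
  by case: (z \in I) => [->|_] //; case: (z \in J).
have a1 := a01 x xI xJ.
have [JI|/subsetPn [y yJ yI]] := boolP (J \subset I).
  have b1 : b = -1.
    have jI := subsetP JI j jJ.
    case: (ab01 j jJ jI); rewrite a1; first by move/eqP; rewrite addrC addr_eq0 => /eqP.
    by move/(canRL (addKr _)); rewrite addNr => /eqP; rewrite (negPf b0).
  split; first by rewrite /laminar JI !orbT.
  apply: toK => z; rewrite !inE a1 b1; have := subsetP JI z.
  by case: (z \in J) => [->|_] //; case: (z \in I).
have b1 := b01 y yJ yI.
have dIJ : [disjoint I & J].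
  rewrite disjoint_subset; apply/subsetP => z zI; rewrite inE; apply/negP => zJ.
  by case: (ab01 z zJ zI); rewrite a1 b1.
split; first by rewrite /laminar dIJ.
apply: toK => z; rewrite !inE a1 b1; have := disjointFr dIJ (x := z).
by case: (z \in I) => // [->|_]; case: (z \in J).
Qed.

(** Equality being transitive, the sum of the three tests is 0, 1 or 3; the value 1 says that
    exactly two of the three colours agree. *)
Definition rank2_colouring (C : eqType) n (A : {set {set 'I_n}})
    (c : {set 'I_n} -> C) : Prop :=
  forall I J, I \in A -> J \in A -> I != J ->
  let K := symdiff I J in
  if laminar I J && (K \in A)
  then ((c I == c J) + (c J == c K) + (c I == c K) = 1)%N
  else c I != c J.

Lemma free_pair n (P : {set {set {set 'I_n}}}) (F : {set {set 'I_n}} -> {set 'I_n})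
    (C D E : {set {set 'I_n}}) (a b : rat) :
  C \in P -> D \in P -> E \in P -> C != D -> D != E -> C != E ->
  free [seq form (F X) | X <- enum P] ->
  form (F E) = a *: form (F C) + b *: form (F D) -> False.
Proof.
move=> CP DP EP CD DE CE freeP Eab.
pose r := [seq X <- enum P | X \notin [:: E; C; D]].
have pr : perm_eq (enum P) ([:: E; C; D] ++ r).
  apply: uniq_perm; first exact: enum_uniq.
    rewrite cat_uniq filter_uniq ?enum_uniq // andbT; apply/andP; split.
      by rewrite /= !inE negb_or eq_sym CE eq_sym DE CD.
    by apply/hasPn => X; rewrite mem_filter => /andP[].
  move=> X; rewrite mem_cat mem_enum /r mem_filter mem_enum; case: (boolP (X \in [:: E; C; D])) => //=.
  by rewrite !inE => /or3P [] /eqP ->.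
move: freeP; rewrite (perm_free (perm_map _ pr)) map_cat => /catl_free /=.
rewrite free_cons Eab => /andP [/negP H _]; apply: H.
by rewrite memvD // memvZ // memv_span // !inE eqxx ?orbT.
Qed.

(** The flat of [I] and [J] is contained in no hyperplane of [A] besides theirs and possibly that of
    [K]. Its singleton block holds one of these sets, whose colour then differs from those of the
    others. If [K] is present, three distinct colours are impossible, since a transversal through
    the three dependent forms would not be free; so the other two sets share a colour. *)
Lemma nice_partition_rank2 n (A : {set {set 'I_n}}) P : set0 \notin A ->
  nice_partition A P -> rank2_colouring A (pblock P).
Proof.
move=> A0 [partP indepP singP] I J IA JA IneJ K.
have [/eqP covP trivP P0] := and3P partP.
have nz L : L \in A -> L != set0 by apply: contraTneq => ->.
have blockP L : L \in A -> pblock P L \in P by move=> LA; rewrite pblock_mem ?covP.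
have inblock L : L \in A -> L \in pblock P L by move=> LA; rewrite mem_pblock covP.
pose X := flat [set I; J].
have XI : (X <= hyp I)%MS by rewrite flat_sub // !inE eqxx.
have XJ : (X <= hyp J)%MS by rewrite flat_sub // !inE eqxx orbT.
have [||D DP /eqP/cards1P [L DL]] := singP [set I; J].
- by apply/subsetP => L /set2P [] ->.
- apply/negP => /submx_trans/(_ XI) full.
  have /set0Pn [i iI] := nz I IA.
  have : ((delta_mx 0 i : 'rV[rat]_n) <= hyp I)%MS := submx_trans (submx1 _) full.
  rewrite sub_hyp /coord_sum (bigD1 i) //= big1 ?mxE ?eqxx ?addr0 //.
  by move=> j /andP [_ /negPf ji]; rewrite mxE ji andbF.
have {}DL M : (M \in D) && (X <= hyp M)%MS = (M == L).
  by have /setP/(_ M) := DL; rewrite !inE.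
have /andP [LD XL] : (L \in D) && (X <= hyp L)%MS by rewrite DL.
have LA : L \in A by rewrite -covP; apply/bigcupP; exists D.
have cL : pblock P L = D by apply: def_pblock.
have only M : M \in A -> (X <= hyp M)%MS -> M != L -> pblock P M != pblock P L.
  move=> MA XM; apply: contraNneq => cM; rewrite -DL XM andbT -cL -cM.
  exact: inblock.
have LIJK := flat2_sub_hypE IneJ (nz I IA) (nz J JA) (nz L LA) XL.
have [/andP [lamIJ KA]|notK] := ifP; last first.
  case: LIJK => [LI|LJ|[lamIJ LK]].
  - by rewrite eq_sym -LI only // LI eq_sym.
  - by rewrite -LJ only // LJ.
  - by move: notK; rewrite lamIJ /K -LK LA.
have KneI : K != I.
  apply: contraNneq (nz J JA) => KI; apply/eqP/setP => x; have /setP/(_ x) := KI.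
  by rewrite !inE; case: (x \in I); case: (x \in J).
have KneJ : K != J.
  apply: contraNneq (nz I IA) => KJ; apply/eqP/setP => x; have /setP/(_ x) := KJ.
  by rewrite !inE; case: (x \in I); case: (x \in J).
have [a [b Kab]] := form_symdiff lamIJ; rewrite -/K in Kab.
have XK : (X <= hyp K)%MS.
  apply/flat_sub_hypP => u uX; rewrite coord_sumE Kab linearD !linearZ /=.
  rewrite mulmxDr -!scalemxAr !mxE.
  have uI : coord_sum u I = 0 by apply/eqP; rewrite -sub_hyp (submx_trans uX).
  have uJ : coord_sum u J = 0 by apply/eqP; rewrite -sub_hyp (submx_trans uX).
  by move: uI uJ; rewrite !coord_sumE !mxE => -> ->; rewrite !mulr0 addr0.
have some_eq : [|| pblock P I == pblock P J, pblock P J == pblock P K |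
                  pblock P I == pblock P K].
  apply/negP => /negP; rewrite !negb_or => /and3P [cIJ cJK cIK].
  (* A transversal through [I], [J] and [K]; in the remaining blocks any member will do. *)
  pose F C := if C == pblock P I then I else if C == pblock P J then J else
    if C == pblock P K then K else odflt set0 [pick L in C].
  have FI : F (pblock P I) = I by rewrite /F eqxx.
  have FJ : F (pblock P J) = J by rewrite /F eq_sym (negPf cIJ) eqxx.
  have FK : F (pblock P K) = K.
    by rewrite /F eq_sym (negPf cIK) eq_sym (negPf cJK) eqxx.
  apply: (@free_pair _ P F (pblock P I) (pblock P J) (pblock P K) a b) => //;
    try exact: blockP; last by rewrite FI FJ FK.
  apply: indepP => C CP; rewrite /F.
  case: eqP => [->|_]; first exact: inblock.
  case: eqP => [->|_]; first exact: inblock.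
  case: eqP => [->|_]; first exact: inblock.
  case: pickP => //= C0; case/negP: P0; suff <- : C = set0 by [].
  by apply/setP => x; rewrite C0 inE.
have JneI : J != I by rewrite eq_sym.
case: LIJK some_eq => [LI|LJ|[_ LK]].
- move: (only J JA XJ) (only K KA XK); rewrite LI.
  move=> /(_ JneI) /negPf nJ /(_ KneI) /negPf nK.
  by rewrite ![pblock P I == _]eq_sym nJ nK /= orbF => ->.
- move: (only I IA XI) (only K KA XK); rewrite LJ.
  move=> /(_ IneJ) /negPf nI /(_ KneJ) /negPf nK.
  by rewrite [pblock P J == _]eq_sym nI nK /= => ->.
- move: (only I IA XI) (only J JA XJ); rewrite LK -/K.
  rewrite ![_ == K]eq_sym => /(_ KneI) /negPf nI /(_ KneJ) /negPf nJ.
  by rewrite nI nJ !orbF => ->.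
Qed.

Local Close Scope ring_scope.

(** * Induced minors and a search for colourings *)

Definition edge_in (E : seq (nat * nat)) (i j : nat) : bool :=
  ((i, j) \in E) || ((j, i) \in E).

(* The fibres of g over 0, ..., m - 1 are the branch sets of an induced minor
   with edge set E; vertices sent to m or beyond are deleted. *)
Definition minor_model n (e : rel 'I_n) (m : nat) (E : seq (nat * nat))
    (g : 'I_n -> nat) : Prop :=
  [/\ forall i, i < m -> induced_connected e [set x | g x == i],
      forall i j, i < m -> j < m -> i != j -> edge_in E i j ->
        exists x y, [/\ g x = i, g y = j & e x y] &
      forall x y, g x < m -> g y < m -> g x != g y -> e x y ->
        edge_in E (g x) (g y)].

(* In increasing order when read as binary numbers, lowest bit first; the
   search prunes much better in this order than in most others. *)
Fixpoint masks (m : nat) : seq bitseq :=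
  if m is m'.+1 then [seq b :: s | s <- masks m', b <- [:: false; true]]
  else [:: [::]].

Definition mask_sub m (s t : bitseq) : bool :=
  all (fun i => nth false s i ==> nth false t i) (iota 0 m).

Definition mask_disj m (s t : bitseq) : bool :=
  all (fun i => ~~ (nth false s i && nth false t i)) (iota 0 m).

Definition mask_lam m (s t : bitseq) : bool :=
  [|| mask_disj m s t, mask_sub m s t | mask_sub m t s].

Definition mask_xor m (s t : bitseq) : bitseq :=
  mkseq (fun i => nth false s i (+) nth false t i) m.

Definition mask_conn m (E : seq (nat * nat)) (s : bitseq) : bool :=
  has id s &&
  all (fun t => [&& mask_sub m t s, has id t & t != s] ==>
         has (fun i => has (fun j => [&& nth false t i, nth false s j,
                ~~ nth false t j & edge_in E i j]) (iota 0 m)) (iota 0 m))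
      (masks m).

(* Depth-first search for a colouring, up to renaming of the colours: the next
   mask gets either one of the k colours in use or the fresh colour k. *)
Definition colour_ok m (V : seq bitseq) (asg : seq (bitseq * nat)) s j : bool :=
  all (fun p => let z := mask_xor m s p.1 in
    if mask_lam m s p.1 && (z \in V)
    then all (fun q => (q.1 == z) ==>
           ((j == p.2) + (p.2 == q.2) + (j == q.2) == 1)) asg
    else j != p.2) asg.

Fixpoint colour_search m V (todo : seq bitseq) (asg : seq (bitseq * nat)) k : bool :=
  if todo is s :: todo' then
    (* not [&&], whose arguments vm_compute evaluates both *)
    has (fun j => if colour_ok m V asg s j
           then colour_search m V todo' ((s, j) :: asg) (maxn k j.+1)
           else false) (iota 0 k.+1)
  else true.

Definition colourable_minor m E : bool :=
  let V := [seq s <- masks m | mask_conn m E s] in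
  colour_search m V V [::] 0.

Lemma mem_masks m s : (s \in masks m) = (size s == m).
Proof.
elim: m s => [|m IHm] [|b s] //; first by apply/negbTE/negP => /allpairsP [[? ?] []].
rewrite [size _]/= eqSS -IHm /masks -/masks; apply/allpairsP/idP => [[[t c] /= [tm _ [_ ->]]] //|sm].
by exists (s, b); split=> //; case: b.
Qed.

Lemma masks_uniq m : uniq (masks m).
Proof.
elim: m => // m IHm; rewrite /masks -/masks; apply: allpairs_uniq => //.
by move=> [s b] [t c] _ _ /= [-> ->].
Qed.

(** Pulls a vertex set of the minor back to the graph. A vertex whose value under [g] exceeds the
    mask reads the default [false], which is how deleted vertices stay out. *)
Definition mask_set n (g : 'I_n -> nat) (s : bitseq) : {set 'I_n} :=
  [set x | nth false s (g x)].

Lemma nth_mask_lt m (s : bitseq) i : size s = m -> nth false s i -> i < m.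
Proof. by move=> <-; apply: contraTT; rewrite -leqNgt => ?; rewrite nth_default. Qed.

Lemma mask_set_xor n (g : 'I_n -> nat) m s t : size s = m -> size t = m ->
  mask_set g (mask_xor m s t) = symdiff (mask_set g s) (mask_set g t).
Proof.
move=> sm tm; apply/setP => x; rewrite !inE.
have [gm|mg] := ltnP (g x) m; last by rewrite !nth_default ?sm ?tm ?size_mkseq.
by rewrite nth_mkseq //; case: (nth _ s _); case: (nth _ t _).
Qed.

Section Minor.

Variables (n : nat) (e : rel 'I_n) (m : nat) (E : seq (nat * nat)) (g : 'I_n -> nat).
Hypotheses (e_sym : symmetric e) (modelg : minor_model e m E g).

Lemma model_onto i : i < m -> exists x, g x = i.
Proof.
case: modelg => + _ _ => /[apply] /andP [/set0Pn [x]]; rewrite inE => /eqP <- _.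
by exists x.
Qed.

Lemma mask_setS s t : size s = m -> (mask_set g s \subset mask_set g t) = mask_sub m s t.
Proof.
move=> sm; apply/subsetP/allP => [st i|st x].
  rewrite mem_iota /= add0n => /model_onto [x <-]; apply/implyP => sx.
  by have := st x; rewrite !inE; apply.
rewrite !inE => sx; apply: (implyP (st _ _)) => //.
by rewrite mem_iota (nth_mask_lt sm sx).
Qed.

Lemma mask_set_disjoint s t : size s = m ->
  [disjoint mask_set g s & mask_set g t] = mask_disj m s t.
Proof.
move=> sm; rewrite disjoint_subset; apply/subsetP/allP => [st i|st x].
  rewrite mem_iota /= add0n => /model_onto [x <-]; rewrite negb_and -implybE.
  by apply/implyP => sx; have := st x; rewrite !inE; apply.
rewrite !inE => sx; have /st : g x \in iota 0 m by rewrite mem_iota (nth_mask_lt sm sx).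
by rewrite sx.
Qed.

Lemma mask_set_laminar s t : size s = m -> size t = m ->
  laminar (mask_set g s) (mask_set g t) = mask_lam m s t.
Proof. by move=> sm tm; rewrite /laminar mask_set_disjoint // !mask_setS. Qed.

Lemma mask_set_inj s t : size s = m -> size t = m ->
  mask_set g s = mask_set g t -> s = t.
Proof.
move=> sm tm st; apply: (@eq_from_nth _ false); rewrite ?sm // => i /model_onto [x <-].
by have /setP/(_ x) := st; rewrite !inE.
Qed.

Lemma mask_set0 s : size s = m -> (mask_set g s != set0) = has id s.
Proof.
move=> sm; apply/set0Pn/(has_nthP false) => [[x]|[i]].
  by rewrite inE => sx; exists (g x) => //; rewrite sm (nth_mask_lt sm sx).
by rewrite sm => /model_onto [x <-] sx; exists x; rewrite inE.
Qed.

(** A cut [U] of the pulled-back set either splits a fibre, which is connected and supplies the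
    edge, or is a union of fibres, hence the pull-back of a cut [t] of the mask. *)
Lemma mask_set_connected s : size s = m ->
  induced_connected e (mask_set g s) = mask_conn m E s.
Proof.
case: modelg => fib_conn edge_ex edge_adj sm.
apply/(induced_connected_cutP _ e_sym)/andP => -[s0 cut]; split.
- by rewrite -mask_set0.
- apply/allP => t; rewrite mem_masks => /eqP tm; apply/implyP => /and3P [ts t0 tnes].
  have [||//|x [y []]] := cut (mask_set g t).
  + by rewrite mask_setS.
  + by rewrite mask_set0.
  + by apply: contraNneq tnes => /(mask_set_inj tm sm) ->.
  rewrite !inE => tx /andP [ty sy] exy.
  apply/hasP; exists (g x); first by rewrite mem_iota (nth_mask_lt tm tx).
  apply/hasP; exists (g y); first by rewrite mem_iota (nth_mask_lt sm sy).
  rewrite tx sy ty; apply: edge_adj => //; rewrite ?(nth_mask_lt tm tx) ?(nth_mask_lt sm sy) //.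
  by apply: contraNneq ty => <-.
- by rewrite mask_set0.
move=> U Us U0 Unes.
pose F i := [set x | g x == i].
have Fs i : nth false s i -> F i \subset mask_set g s.
  by move=> si; apply/subsetP => x; rewrite !inE => /eqP ->.
have [/existsP [i /and3P [si FU0 FU]]|/existsPn whole] :=
  boolP [exists i : 'I_m, [&& nth false s i, U :&: F i != set0 & ~~ (F i \subset U)]].
  have /(induced_connected_cutP _ e_sym) [_ cutF] := fib_conn i (ltn_ord i).
  have [|x [y []]] := cutF (U :&: F i) (subsetIr _ _) FU0.
    by apply: contraNneq FU => /setIidPr.
  rewrite !inE => /andP [xU _] /andP [yU yi] exy; exists x, y; split=> //.
  by rewrite !inE; move: yU; rewrite yi andbT => ->; rewrite (eqP yi).
have {}whole x y : x \in U -> nth false s (g y) -> g x = g y -> y \in U.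
  move=> xU sy xy; have := whole (Ordinal (nth_mask_lt sm sy)); rewrite /= sy /=.
  rewrite negb_and !negbK => /orP [/eqP|/subsetP/(_ y)].
    by move/setP/(_ x); rewrite !inE xU xy eqxx.
  by rewrite inE eqxx; apply.
pose t := mkseq (fun i => nth false s i && [exists x in U, g x == i]) m.
have tE y : nth false s (g y) -> nth false t (g y) = (y \in U).
  move=> sy; rewrite nth_mkseq ?(nth_mask_lt sm sy) // sy /=.
  apply/exists_inP/idP => [[x xU /eqP xy]|yU]; first exact: whole xU sy xy.
  by exists y.
have tm : size t = m by rewrite size_mkseq.
have Ut : mask_set g t = U.
  apply/setP => x; rewrite inE; have [gx|gx] := boolP (nth false s (g x)).
    by rewrite tE.
  transitivity false; last first.
    by apply/esym/negbTE; apply: contra gx => /(subsetP Us); rewrite inE.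
  have [gm|mg] := ltnP (g x) m; last by rewrite nth_default ?tm.
  by rewrite nth_mkseq // (negPf gx).
have := allP cut t; rewrite mem_masks tm eqxx => /(_ isT).
rewrite -mask_setS // -mask_set0 // Ut Us U0 /=.
have -> : t != s by apply: contraNneq Unes => ts; rewrite -Ut ts.
move=> /hasP [i _ /hasP [j _ /and4P [ti sj tj Eij]]].
have im := nth_mask_lt tm ti; have jm := nth_mask_lt sm sj.
have [|x [y [xi yj exy]]] := edge_ex i j im jm _ Eij.
  by apply: contraNneq tj => <-.
exists x, y; rewrite -Ut !inE xi yj ti sj tj.
by [].
Qed.

(** Invariant: the numbers in [asg] coincide exactly where the colours under [c] do, so [asg] is a
    renaming of part of [c]. The branch that follows [c] never fails: a colour already met keeps its
    number, and a new one takes the fresh number [k]. *)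
Lemma colour_search_sound (C : eqType) (c : {set 'I_n} -> C) V todo asg k :
  rank2_colouring (CSA e) c ->
  V = [seq s <- masks m | mask_conn m E s] ->
  {subset todo <= V} -> {subset unzip1 asg <= V} -> uniq (todo ++ unzip1 asg) ->
  (forall p, p \in asg -> p.2 < k) ->
  (forall p q, p \in asg -> q \in asg ->
     (p.2 == q.2) = (c (mask_set g p.1) == c (mask_set g q.1))) ->
  colour_search m V todo asg k.
Proof.
move=> cA VE.
have inV s : s \in V -> size s = m /\ mask_set g s \in CSA e.
  rewrite VE mem_filter mem_masks => /andP [sc /eqP sm].
  by rewrite inE mask_set_connected.
elim: todo asg k => [|s todo IHt] asg k // sub_todo sub_asg uniq_sa asg_lt asg_col.
have sV : s \in V by rewrite sub_todo ?mem_head.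
have [sm sA] := inV s sV.
have asgV p : p \in asg -> p.1 \in V by move=> pa; apply: sub_asg; apply: map_f.
have sub_todo' : {subset todo <= V} by move=> t tt; rewrite sub_todo // inE tt orbT.
have sub_asg' j : {subset unzip1 ((s, j) :: asg) <= V}.
  by move=> t /=; rewrite inE => /predU1P [->|/sub_asg].
have uniq' j : uniq (todo ++ unzip1 ((s, j) :: asg)).
  by rewrite -[unzip1 _]cat1s uniq_catCA.
have s_new p : p \in asg -> p.1 != s.
  move=> pa; move: uniq_sa; rewrite cat_cons cons_uniq mem_cat negb_or => /andP [/andP [_ sa] _].
  by apply: contraNneq sa => <-; apply: map_f.
suff [j jk jcol] : exists2 j, j <= k &
    forall p, p \in asg -> (j == p.2) = (c (mask_set g s) == c (mask_set g p.1)).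
  rewrite /colour_search -/colour_search.
  apply/hasP; exists j; first by rewrite mem_iota.
  rewrite ifT.
    apply: IHt => // [p|p q]; rewrite !inE.
      by move=> /predU1P [->|/asg_lt]; rewrite leq_max ?ltnSn ?orbT // => ->.
    move=> /predU1P [->|pa] /predU1P [->|qa] /=; rewrite ?eqxx ?jcol ?asg_col //.
    by rewrite eq_sym jcol // eq_sym.
  apply/allP => p pa; have [pm pA] := inV _ (asgV p pa).
  have sp : mask_set g s != mask_set g p.1.
    by apply: contraNneq (s_new p pa) => /(mask_set_inj sm pm) ->.
  have := cA _ _ sA pA sp; rewrite /= -(mask_set_xor g sm pm) mask_set_laminar //.
  have zm : size (mask_xor m s p.1) = m by rewrite size_mkseq.
  have -> : (mask_set g (mask_xor m s p.1) \in CSA e) = (mask_xor m s p.1 \in V).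
    by rewrite VE mem_filter mem_masks zm eqxx andbT inE mask_set_connected.
  case: ifP => _; last by rewrite jcol.
  move=> one; apply/allP => q qa; apply/implyP => /eqP qz.
  by rewrite !jcol // asg_col // qz one.
have [/hasP [p pa /eqP cp]|/hasPn new] :=
  boolP (has (fun p => c (mask_set g p.1) == c (mask_set g s)) asg).
  by exists p.2 => [|q qa]; [rewrite ltnW ?asg_lt|rewrite asg_col // cp].
exists k => // p pa; rewrite eq_sym [RHS]eq_sym (negPf (new p pa)).
by apply/negbTE; rewrite neq_ltn asg_lt.
Qed.

Lemma factored_minor_colourable : factored (CSA e) -> colourable_minor m E.
Proof.
case=> P niceP; apply: (@colour_search_sound _ (pblock P)) => //.
- by apply: nice_partition_rank2 niceP; rewrite inE /induced_connected eqxx.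
- by rewrite cats0 filter_uniq ?masks_uniq.
Qed.

End Minor.

(** * The excluded induced minors *)

Definition claw := [:: (0, 1); (1, 2); (1, 3)].
Definition four_cycle := [:: (0, 1); (1, 2); (2, 3); (3, 0)].
Definition diamond := [:: (0, 1); (1, 2); (2, 3); (3, 0); (1, 3)].
Definition complete4 := [:: (0, 1); (0, 2); (0, 3); (1, 2); (1, 3); (2, 3)].
Definition bull := [:: (0, 1); (0, 2); (1, 2); (0, 3); (1, 4)].
Definition bowtie := [:: (0, 1); (0, 2); (1, 2); (0, 3); (0, 4); (3, 4)].

(** Of the six connected graphs on four vertices, only the path and the triangle with a pendant edge
    are missing here. The bull forbids a second arm at the triangle, the bowtie a second triangle at
    the far end of the arm. *)
Definition obstructions :=
  [:: (4, claw); (4, four_cycle); (4, diamond); (4, complete4); (5, bull); (5, bowtie)].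

Lemma obstructions_not_colourable :
  all (fun o => ~~ colourable_minor o.1 o.2) obstructions.
Proof. by vm_compute. Qed.

Lemma factored_no_obstruction n (e : rel 'I_n) m E g : symmetric e ->
  factored (CSA e) -> (m, E) \in obstructions -> minor_model e m E g -> False.
Proof.
move=> e_sym facA /(allP obstructions_not_colourable) /negP noncol modelg.
exact/noncol/(factored_minor_colourable e_sym modelg).
Qed.

(** * Growing an induced path or path-with-triangle *)

Section Embedding.

Variables (n : nat) (e : rel 'I_n).
Hypotheses (e_sym : symmetric e) (e_irr : irreflexive e).

(** [f] is total on [nat], so that vertices can be renumbered by plain arithmetic; only its values
    below [K] matter. *)
Definition embeds (K : nat) (r : rel nat) (f : nat -> 'I_n) : Prop :=
  (forall i j, i < K -> j < K -> f i = f j -> i = j) /\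
  (forall i j, i < K -> j < K -> e (f i) (f j) = r i j).

Lemma embeds_comp K r f K' r' t : embeds K r f ->
  (forall i, i < K' -> t i < K) ->
  (forall i j, i < K' -> j < K' -> t i = t j -> i = j) ->
  (forall i j, i < K' -> j < K' -> r' i j = r (t i) (t j)) ->
  embeds K' r' (f \o t).
Proof.
move=> [f_inj f_edge] tK t_inj r't; split=> i j iK jK /=; last by rewrite f_edge ?tK ?r't.
by move=> /f_inj H; apply: t_inj => //; apply: H; apply: tK.
Qed.

Definition attach (K : nat) (r : rel nat) (T : pred nat) : rel nat := fun i j =>
  if i == K then (j != K) && T j else if j == K then T i else r i j.

Lemma embeds_attach K r f v : embeds K r f -> (forall i, i < K -> f i != v) ->
  embeds K.+1 (attach K r (fun i => e v (f i))) (fun i => if i == K then v else f i).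
Proof.
move=> [f_inj f_edge] fv; split=> i j; rewrite /attach !ltnS => iK jK.
  case: eqP => [->|/eqP i_ne]; case: eqP => [->|/eqP j_ne] //.
  - by move=> /eqP; rewrite eq_sym (negPf (fv j _)) // ltn_neqAle j_ne.
  - by move=> /eqP; rewrite (negPf (fv i _)) // ltn_neqAle i_ne.
  - by apply: f_inj; rewrite ltn_neqAle ?i_ne ?j_ne.
case: eqP => [_|/eqP i_ne]; case: eqP => [_|/eqP j_ne] //=.
by apply: f_edge; rewrite ltn_neqAle ?i_ne ?j_ne.
Qed.

(** Turns the conditions on an induced minor into arithmetic on indices. The hypothesis on [j.-1]
    makes each fibre of [h] below [m] a run of consecutive numbers, each adjacent to its
    predecessor, and so makes the branch sets connected. *)
Lemma embeds_model K r f m E (h : nat -> nat) : embeds K r f ->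
  (forall c, c < m -> exists2 i, i < K & h i = c) ->
  (forall i j, i < j -> j < K -> h i = h j -> h j < m -> h j.-1 = h j /\ r j.-1 j) ->
  (forall c d, (c, d) \in E -> exists i j, [/\ i < K, j < K, h i = c, h j = d & r i j]) ->
  (forall i j, i < K -> j < K -> h i < m -> h j < m -> h i != h j -> r i j ->
     edge_in E (h i) (h j)) ->
  exists g, minor_model e m E g.
Proof.
move=> [f_inj f_edge] onto_h int_h E_r r_E.
pose s := [seq f i | i <- iota 0 K].
have index_f i : i < K -> index (f i) s = i.
  move=> iK; have {1}<- : nth (f 0) s i = f i.
    by rewrite (nth_map 0) ?size_iota // nth_iota.
  rewrite index_uniq ?size_map ?size_iota // map_inj_in_uniq ?iota_uniq //.
  by move=> a b; rewrite !mem_iota => aK bK; apply: f_inj.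
(* Vertices outside the embedded subgraph get the value [m], which deletes them. *)
pose g x := if index x s < K then h (index x s) else m.
have gP x : g x < m -> exists2 i, i < K & x = f i.
  rewrite /g; case: ifP => [xs _|_]; last by rewrite ltnn.
  have : x \in s by rewrite -index_mem size_map size_iota.
  by case/mapP => i; rewrite mem_iota => /andP [_ iK] ->; exists i.
have gf i : i < K -> g (f i) = h i by move=> iK; rewrite /g index_f // iK.
exists g; split=> [c cm|c d cm dm _|x y]; last 1 first.
- move=> gx gy; have [i iK xi] := gP x gx; have [j jK yj] := gP y gy.
  move: gx gy; rewrite xi yj !gf // f_edge //; exact: r_E.
(* The part of a branch set up to index [i] is connected, by induction on [i]; at the largest index
   it is the whole branch set. *)
- have fib i : i < K -> h i = c -> induced_connected e
      [set x | [exists j : 'I_K, [&& j <= i, h j == c & x == f j]]].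
    elim/ltn_ind: i => i IHi iK hi.
    have [lower|first_i] := boolP [exists j : 'I_K, (j < i) && (h j == c)].
      have /existsP [j /andP [ji /eqP hj]] := lower.
      have [||hi1 ri] := int_h j i ji iK; rewrite ?hi ?hj //.
      have i1 : i.-1 < i by lia.
      have i1K : i.-1 < K by lia.
      have := IHi _ i1 i1K (etrans hi1 hi).
      set F := [set _ | _] => F_conn.
      suff -> : [set x | [exists j : 'I_K, [&& j <= i, h j == c & x == f j]]] = F :|: [set f i].
        apply: (@induced_connectedU _ e F [set f i] (f i.-1) (f i)) => //.
        + exact: induced_connected1.
        + by rewrite inE; apply/existsP; exists (Ordinal i1K); rewrite /= leqnn hi1 hi !eqxx.
        + by rewrite set11.
        + by rewrite f_edge // ri orbT.
      apply/setP => x; rewrite !inE; apply/existsP/orP => [[l /and3P [li hl xl]]|].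
        have [l_i|l_i] := eqVneq (l : nat) i; first by right; rewrite -l_i.
        left; apply/existsP; exists l; rewrite hl xl !andbT; lia.
      case=> [/existsP [l /and3P [li hl xl]]|xi].
        by exists l; rewrite hl xl !andbT; lia.
      by exists (Ordinal iK); rewrite /= leqnn hi eqxx.
    suff -> : [set x | [exists j : 'I_K, [&& j <= i, h j == c & x == f j]]] = [set f i].
      exact: induced_connected1.
    apply/setP => x; rewrite !inE; apply/existsP/idP => [[l /and3P [li hl /eqP ->]]|xi].
      move: first_i; rewrite negb_exists => /forallP /(_ l); rewrite hl andbT -leqNgt => il.
      by have -> : (l : nat) = i by lia.
    by exists (Ordinal iK); rewrite /= leqnn hi eqxx.
  have [i0 i0K hi0] := onto_h c cm.
  have ex_top : exists i, (i < K) && (h i == c) by exists i0; rewrite i0K hi0 eqxx.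
  have bound i : (i < K) && (h i == c) -> i <= K by case/andP => /ltnW.
  case: (ex_maxnP ex_top bound) => i /andP [iK /eqP hi] imax.
  suff -> : [set x | g x == c] =
     [set x | [exists j : 'I_K, [&& j <= i, h j == c & x == f j]]] by exact: fib.
  apply/setP => x; rewrite !inE; apply/eqP/existsP => [gx|[j /and3P [_ /eqP hj /eqP ->]]].
    have := gP x; rewrite gx => /(_ cm) [j jK xj].
    have hj : h j = c by rewrite -gf -?xj.
    by exists (Ordinal jK); rewrite /= hj xj !eqxx imax // jK hj eqxx.
  by rewrite gf.
- move=> Ecd; have [] := orP Ecd => /E_r [i [j [iK jK hi hj rij]]].
    by exists (f i), (f j); rewrite !gf // f_edge.
  by exists (f j), (f i); rewrite !gf // e_sym f_edge.
Qed.

End Embedding.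
Definition path_nat : rel nat := fun i j => (i.+1 == j) || (j.+1 == i).
Definition delta_nat (k : nat) : rel nat := fun i j => delta_edge k i j || delta_edge k j i.

Section Obstruction.

Variables (n : nat) (e : rel 'I_n).
Hypotheses (e_sym : symmetric e) (e_irr : irreflexive e) (facA : factored (CSA e)).

Lemma no_obstruction_embeds m E f : (m, E) \in obstructions ->
  embeds e m (edge_in E) f -> False.
Proof.
move=> ob emb; have [|||i j|g] := @embeds_model _ e e_sym _ _ _ m E id emb.
- by move=> c cm; exists c.
- by move=> i j ij _ ji; rewrite ji ltnn in ij.
- move=> c d Ecd.
  have /andP [cm dm] : (c < m) && (d < m).
    have /allP/(_ _ ob)/allP/(_ _ Ecd) // :
      all (fun o => all (fun p => (p.1 < o.1) && (p.2 < o.1)) o.2) obstructions by [].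
  by exists c, d; rewrite /edge_in Ecd.
- by [].
- exact: (factored_no_obstruction e_sym facA ob).
Qed.

(* The branch sets are the vertex a, the open interval between a and b, the
   vertex b and the attached vertex. *)
Lemma path_attach K T f a b i : embeds e K.+1 (attach K path_nat T) f ->
  a.+1 < b -> b < K -> T a = T b -> a <= i <= b -> ~~ T i.
Proof.
move=> emb ab bK Tab /andP [ai ib]; apply/negP => Ti.
pose tm := has T (iota a.+1 (b - a.+1)).
have tmP : reflect (exists2 j, a < j < b & T j) tm.
  apply: (iffP hasP) => -[j]; first by rewrite mem_iota => ? ?; exists j => //; lia.
  by move=> ? ?; exists j => //; rewrite mem_iota; lia.
(* If [T a] holds, the minor is a diamond or a 4-cycle, according to whether the new vertex sees the
   open interval; if not, [T i] puts a neighbour inside the interval and the minor is a claw. *)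
pose E := [:: (0, 1); (1, 2)] ++ (if T a then [:: (2, 3); (3, 0)] else [::]) ++
  (if tm then [:: (1, 3)] else [::]).
(* The value 4 deletes the path vertices outside the interval from [a] to [b]. *)
pose h (j : nat) := if j == K then 3 else if j == a then 0 else if j == b then 2 else
  if a < j < b then 1 else 4.
have hP (j : nat) : h j < 4 ->
    [\/ h j = 3 /\ j = K, h j = 0 /\ j = a, h j = 2 /\ j = b | h j = 1 /\ a < j < b].
  rewrite /h; case: eqP => [->|_]; first by constructor 1.
  case: eqP => [->|_]; first by constructor 2.
  case: eqP => [->|_]; first by constructor 3.
  by case: ifP => // _; constructor 4.
have hK : h K = 3 by rewrite /h eqxx.
have ha : h a = 0 by rewrite /h eqxx ifF //; lia.
have hb : h b = 2 by rewrite /h eqxx !ifF //; lia.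
have hm j : a < j < b -> h j = 1 by move=> jab; rewrite /h jab !ifF //; lia.
have inE_ob : (4, E) \in obstructions.
  rewrite /E; have [Ta|nTa] := boolP (T a); case: (tmP) => // notm.
  case: notm; exists i => //; rewrite !ltn_neqAle ai ib !andbT.
  by apply/andP; split; apply: contraTneq Ti; [move=> <-|move=> ->; rewrite -Tab].
have pathF x y : path_nat x y = (x.+1 == y) || (y.+1 == x) by [].
have r_path x y : x < K -> y < K -> attach K path_nat T x y = path_nat x y.
  by move=> xK yK; rewrite /attach !ifF //; lia.
have r_apex x : x < K -> attach K path_nat T K x = T x.
  by move=> xK; rewrite /attach eqxx ltn_eqF.
have r_apex' x : x < K -> attach K path_nat T x K = T x.
  by move=> xK; rewrite /attach eqxx ltn_eqF.
have [||||g] := @embeds_model _ e e_sym _ _ _ 4 E h emb;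
  last exact: (factored_no_obstruction e_sym facA inE_ob).
- case=> [|[|[|[|//]]]] _.
  + by exists a => //; lia.
  + by exists a.+1; [lia|apply: hm; lia].
  + by exists b => //; lia.
  + by exists K.
- move=> x y xy yK hxy hy4; have := hP y hy4; have := hP x; rewrite hxy => /(_ hy4).
  case=> -[hx xE]; rewrite hx; case=> -[// hy yE];
    try by move: xy; rewrite xE yE ltnn.
  by rewrite hm ?r_path ?pathF; clear -xy xE yE ab bK; lia.
- move=> c d; rewrite /E !mem_cat !inE => /or3P [/orP [] /eqP [-> ->]| |].
  + by exists a, a.+1; split=> //; rewrite ?r_path ?pathF ?hm; lia.
  + by exists b.-1, b; split=> //; rewrite ?r_path ?pathF ?hm; lia.
  + case: ifP => // Ta; rewrite !inE => /orP [] /eqP [-> ->].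
      by exists b, K; split=> //; rewrite ?r_apex' -?Tab //; lia.
    by exists K, a; split=> //; rewrite ?r_apex //; lia.
  + case: tmP => // -[j jab Tj]; rewrite !inE => /eqP [-> ->].
    by exists j, K; split=> //; rewrite ?hm ?r_apex' //; lia.
move=> x y xK yK /hP hx /hP hy.
have edgeC c d : edge_in E c d = edge_in E d c by rewrite /edge_in orbC.
have E01 : edge_in E 0 1 by rewrite /edge_in /E !mem_cat !inE.
have E12 : edge_in E 1 2 by rewrite /edge_in /E !mem_cat !inE.
have E23 : T a -> edge_in E 2 3.
  by rewrite /edge_in /E !mem_cat => ->; rewrite !inE ?orbT.
have E30 : T a -> edge_in E 3 0.
  by rewrite /edge_in /E !mem_cat => ->; rewrite !inE ?orbT.
have E13 z : a < z < b -> T z -> edge_in E 1 3.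
  move=> zab Tz; have Etm : tm by apply/tmP; exists z.
  by rewrite /edge_in /E !mem_cat Etm !inE !orbT.
have far : path_nat a b = false by rewrite pathF; clear -ab; lia.
have farC : path_nat b a = false by rewrite pathF; clear -ab; lia.
have aK : a < K by clear -ab bK; lia.
case: hx => -[-> xE]; case: hy => -[-> yE] // _.
- by rewrite xE yE r_apex.
- by rewrite xE yE r_apex // -Tab edgeC.
- by rewrite xE r_apex ?[edge_in E 3 1]edgeC; [exact: E13|clear -yE bK; lia].
- by rewrite xE yE r_apex' // edgeC.
- by rewrite xE yE r_path // far.
- by rewrite xE yE r_apex' // -Tab.
- by rewrite xE yE r_path // farC.
- by rewrite edgeC E12.
- by rewrite yE r_apex'; [exact: E13|clear -xE bK; lia].
- by rewrite edgeC E01.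
Qed.



End Obstruction.

Section Growth.

Variables (n : nat) (e : rel 'I_n).
Hypotheses (e_sym : symmetric e) (e_irr : irreflexive e) (facA : factored (CSA e)).

Lemma attach_old K r T i j : i < K -> j < K -> attach K r T i j = r i j.
Proof. by move=> iK jK; rewrite /attach !ltn_eqF. Qed.

Lemma attach_l K r T i : i < K -> attach K r T K i = T i.
Proof. by move=> iK; rewrite /attach eqxx ltn_eqF. Qed.

Lemma attach_r K r T i : i < K -> attach K r T i K = T i.
Proof. by move=> iK; rewrite /attach eqxx ltn_eqF. Qed.

Lemma attach_new K r T : attach K r T K K = false.
Proof. by rewrite /attach eqxx. Qed.

(** By [path_attach], two path vertices at distance at least two on which [T] agrees enclose no
    neighbour of the new vertex and are not neighbours themselves. So for K > 2 exactly one end is a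
    neighbour, and every other neighbour is next to that end. *)
Lemma path_attach_end K f T i0 : 0 < K -> embeds e K.+1 (attach K path_nat T) f ->
  i0 < K -> T i0 ->
  (T 0 /\ forall i, 1 < i < K -> ~~ T i) \/
  (T K.-1 /\ forall i, i.+2 < K -> ~~ T i).
Proof.
move=> K0 emb i0K Ti0.
have [K2|K3] := leqP K 2.
  have [i00|i01] : i0 = 0 \/ i0 = K.-1 by clear -K2 i0K; lia.
    by left; rewrite -i00; split=> // i; clear -K2; lia.
  by right; rewrite -i01; split=> // i; clear -K2; lia.
have ends : T 0 != T K.-1.
  apply/eqP => T0; have /negP[] : ~~ T i0.
    by apply: (path_attach e_sym facA emb _ _ T0); clear -K3 i0K; lia.
  exact: Ti0.
have [T0|T0] := boolP (T 0); [left|right]; split=> //.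
- move=> i /andP [i1 iK]; apply/negP => Ti.
  have /negP[] : ~~ T 0 by apply: (path_attach e_sym facA emb i1 iK (etrans T0 (esym Ti))).
  exact: T0.
- by move: ends; rewrite (negPf T0); case: (T K.-1).
have TK : T K.-1 by move: ends; rewrite (negPf T0); case: (T K.-1).
move=> i iK; apply/negP => Ti.
have /negP[] : ~~ T i.
  by apply: (path_attach e_sym facA emb _ _ (etrans Ti (esym TK))); clear -iK K3; lia.
exact: Ti.
Qed.

Lemma path_grows K f T i0 : 0 < K -> embeds e K.+1 (attach K path_nat T) f ->
  i0 < K -> T i0 ->
  exists f', embeds e K.+1 path_nat f' \/ (1 < K /\ embeds e K.+1 (delta_nat K) f').
Proof.
move=> K0 emb i0K Ti0.
have [[T0 Tlow]|[TK Thigh]] := path_attach_end K0 emb i0K Ti0.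
  have [/andP [K1 T1]|T1] := boolP ((1 < K) && T 1).
    have TE x : x < K -> T x = (x <= 1).
      case: x => [|[|x]] xK; [by rewrite T0|by rewrite T1|].
      by apply/negbTE/Tlow.
    exists (f \o id); right; split=> //; apply: (embeds_comp emb) => // i j i_lt j_lt /=.
    have [iK|iK] : i = K \/ i < K by clear -i_lt; lia.
      have [jK|jK] : j = K \/ j < K by clear -j_lt; lia.
        by rewrite iK jK attach_new /delta_nat /delta_edge; clear -K1; lia.
      by rewrite iK attach_l // TE // /delta_nat /delta_edge; clear -jK K1; lia.
    have [jK|jK] : j = K \/ j < K by clear -j_lt; lia.
      by rewrite jK attach_r // TE // /delta_nat /delta_edge; clear -iK K1; lia.
    by rewrite attach_old // /delta_nat /delta_edge /path_nat; clear -iK jK; lia.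
  have TE x : x < K -> T x = (x == 0).
    case: x => [|x] xK; first by rewrite T0.
    apply/negbTE; case: x xK => [|x] xK; last by apply: Tlow.
    by move: T1; rewrite xK.
  (* The new vertex precedes vertex 0, so the old numbers shift by one. *)
  exists (f \o fun i => if i == 0 then K else i.-1); left.
  apply: (embeds_comp emb) => [i|i j|i j].
  - by clear -K0; case: eqP => [?|/eqP]; lia.
  - by clear -K0; case: eqP => ?; case: eqP => ?; lia.
  case: i => [|i] i_lt; case: j => [|j] j_lt /=.
  - by rewrite attach_new.
  - by rewrite attach_l // TE // /path_nat; clear; lia.
  - by rewrite attach_r // TE // /path_nat; clear; lia.
  - by rewrite attach_old // /path_nat; clear; lia.
have [/andP [K1 T1]|T1] := boolP ((1 < K) && T K.-2).
  have TE x : x < K -> T x = (K <= x.+2).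
    move=> xK; have [->|x1] := eqVneq x K.-1; first by rewrite TK; clear -K0; lia.
    have [->|x2] := eqVneq x K.-2; first by rewrite T1; clear -K1; lia.
    by rewrite (negPf (Thigh x _)); clear -x1 x2 xK; lia.
  (* The path is reversed, since [delta_nat] joins the apex to the vertices 0 and 1. *)
  exists (f \o fun i => if i == K then K else K.-1 - i); right; split=> //.
  have revK x : x < K -> K.-1 - x < K by clear; lia.
  apply: (embeds_comp emb) => [i|i j|i j].
  - by clear; case: eqP => [->|]; lia.
  - by clear; case: eqP => ?; case: eqP => ?; lia.
  move=> i_lt j_lt.
  have [iK|iK] : i = K \/ i < K by clear -i_lt; lia.
    have [jK|jK] : j = K \/ j < K by clear -j_lt; lia.
      by rewrite iK jK eqxx attach_new /delta_nat /delta_edge; clear -K1; lia.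
    rewrite iK eqxx [j == K]ltn_eqF // attach_l ?revK // TE ?revK //.
    by rewrite /delta_nat /delta_edge; clear -jK K1; lia.
  have [jK|jK] : j = K \/ j < K by clear -j_lt; lia.
    rewrite jK eqxx [i == K]ltn_eqF // attach_r ?revK // TE ?revK //.
    by rewrite /delta_nat /delta_edge; clear -iK K1; lia.
  rewrite [i == K]ltn_eqF // [j == K]ltn_eqF // attach_old ?revK //.
  by rewrite /delta_nat /delta_edge /path_nat; clear -iK jK; lia.
have TE x : x < K -> T x = (K == x.+1).
  move=> xK; have [->|x1] := eqVneq x K.-1; first by rewrite TK; clear -K0; lia.
  have [x2|x2] := eqVneq x K.-2.
    move: T1; have -> : 1 < K by clear -x2 x1 xK; lia.
    by rewrite -x2 /= => /negPf ->; clear -x2 x1 xK; lia.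
  by rewrite (negPf (Thigh x _)); clear -x1 x2 xK; lia.
exists (f \o id); left; apply: (embeds_comp emb) => // i j i_lt j_lt /=.
have [iK|iK] : i = K \/ i < K by clear -i_lt; lia.
  have [jK|jK] : j = K \/ j < K by clear -j_lt; lia.
    by rewrite iK jK attach_new /path_nat; clear; lia.
  by rewrite iK attach_l // TE // /path_nat; clear -jK; lia.
have [jK|jK] : j = K \/ j < K by clear -j_lt; lia.
  by rewrite jK attach_r // TE // /path_nat; clear -iK; lia.
by rewrite attach_old.
Qed.

End Growth.

(** * Attaching a vertex to a path with a triangle *)

Section GrowthDelta.

Variables (n : nat) (e : rel 'I_n).
Hypotheses (e_sym : symmetric e) (e_irr : irreflexive e) (facA : factored (CSA e)).

Lemma no_obstruction_pick m E K r f (t : seq nat) : (m, E) \in obstructions ->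
  embeds e K r f -> size t = m -> all (gtn K) t -> uniq t ->
  (forall i j, i < m -> j < m -> edge_in E i j = r (nth 0 t i) (nth 0 t j)) -> False.
Proof.
move=> ob emb tm /allP tK ut rE; apply: (no_obstruction_embeds e_sym facA ob (f := f \o nth 0 t)).
apply: (embeds_comp emb) => // [i im|i j im jm /eqP].
  by apply: tK; rewrite mem_nth ?tm.
by rewrite nth_uniq ?tm // => /eqP.
Qed.

Variables (k : nat) (T : pred nat) (f : nat -> 'I_n).
Hypotheses (k2 : 1 < k) (emb : embeds e k.+2 (attach k.+1 (delta_nat k) T) f).

Let R := attach k.+1 (delta_nat k) T.

Lemma delta_attach_r i : i <= k -> R i k.+1 = T i.
Proof. by move=> ik; rewrite /R attach_r. Qed.

Lemma delta_attach_l i : i <= k -> R k.+1 i = T i.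
Proof. by move=> ik; rewrite /R attach_l. Qed.

Lemma delta_attach_old i j : i <= k -> j <= k -> R i j = delta_nat k i j.
Proof. by move=> ik jk; rewrite /R attach_old. Qed.

(** Three neighbours on the triangle 0, 1, k would give a complete graph on four vertices, and two a
    diamond; so there is at most one. *)
Lemma delta_attach_triangle : ~~ (T 0 && T k) /\ ~~ (T 1 && (T 0 || T k)).
Proof.
have k1 : 1 <= k by apply: ltnW.
have ends := (delta_attach_r, delta_attach_l, delta_attach_old).
have kk : delta_nat k k k = false by rewrite /delta_nat /delta_edge; clear -k2; lia.
have k0 : delta_nat k 0 k /\ delta_nat k k 0.
  by split; rewrite /delta_nat /delta_edge; clear -k2; lia.
have kk1 : delta_nat k 1 k /\ delta_nat k k 1.
  by split; rewrite /delta_nat /delta_edge; clear -k2; lia.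
have k01 : delta_nat k 0 1 /\ delta_nat k 1 0.
  by split; rewrite /delta_nat /delta_edge; clear -k2; lia.
have k00 : delta_nat k 0 0 = false by rewrite /delta_nat /delta_edge; clear -k2; lia.
have k11 : delta_nat k 1 1 = false by rewrite /delta_nat /delta_edge; clear -k2; lia.
have vv : R k.+1 k.+1 = false by rewrite /R attach_new.
case: k0 kk1 k01 => [k0 k0'] [kk1 kk1'] [k01 k01'].
have facts := (kk, k0, k0', kk1, kk1', k01, k01', k00, k11, vv).
have pick4 E t : (4, E) \in obstructions -> size t = 4 -> all (gtn k.+2) t -> uniq t ->
    (forall i j, i < 4 -> j < 4 -> edge_in E i j = R (nth 0 t i) (nth 0 t j)) -> False.
  by move=> ob; apply: (no_obstruction_pick ob emb).
case T0: (T 0); case T1: (T 1); case Tk: (T k) => //; exfalso.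
- apply: (pick4 complete4 [:: 0; 1; k; k.+1]) => //=; try by rewrite ?inE; clear -k2; lia.
  by case=> [|[|[|[|//]]]] [|[|[|[|//]]]] _ _ /=; rewrite ?vv ?ends ?facts ?T0 ?T1 ?Tk //.
- apply: (pick4 diamond [:: k.+1; 0; k; 1]) => //=; try by rewrite ?inE; clear -k2; lia.
  by case=> [|[|[|[|//]]]] [|[|[|[|//]]]] _ _ /=; rewrite ?vv ?ends ?facts ?T0 ?T1 ?Tk //.
- apply: (pick4 diamond [:: 1; 0; k.+1; k]) => //=; try by rewrite ?inE; clear -k2; lia.
  by case=> [|[|[|[|//]]]] [|[|[|[|//]]]] _ _ /=; rewrite ?vv ?ends ?facts ?T0 ?T1 ?Tk //.
- apply: (pick4 diamond [:: k.+1; k; 0; 1]) => //=; try by rewrite ?inE; clear -k2; lia.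
  by case=> [|[|[|[|//]]]] [|[|[|[|//]]]] _ _ /=; rewrite ?vv ?ends ?facts ?T0 ?T1 ?Tk //.
Qed.

(** The bull consists of the triangle a, 1, b with the new vertex hanging from [a] and the arm
    vertex 2 hanging from 1. For k > 2 the vertices 0 and k play symmetric roles in the graph. *)
Lemma delta_attach_bull a b : ((a, b) == (0, k)) || ((a, b) == (k, 0)) -> 2 < k ->
  T a -> ~~ T 1 -> ~~ T 2 -> ~~ T b -> False.
Proof.
move=> ab k3 Ta /negPf T1 /negPf T2 /negPf Tb.
have k1 : 1 <= k by apply: ltnW.
have k2' : 2 <= k by [].
have ends := (delta_attach_r, delta_attach_l, delta_attach_old).
have vv : R k.+1 k.+1 = false by rewrite /R attach_new.
apply: (no_obstruction_pick (m := 5) (E := bull) (r := R) _ emb (t := [:: a; 1; b; k.+1; 2])) => //.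
- by case/orP: ab => /eqP [-> ->] /=; clear -k3; lia.
- by case/orP: ab => /eqP [-> ->] /=; rewrite !inE; clear -k3; lia.
case/orP: ab => /eqP [aE bE]; rewrite aE bE in Ta Tb *;
  case=> [|[|[|[|[|//]]]]] [|[|[|[|[|//]]]]] _ _ /=;
  rewrite ?vv ?ends ?Ta ?Tb ?T1 ?T2 // /edge_in !inE !xpair_eqE /= /delta_nat /delta_edge;
  clear -k3; lia.
Qed.

(** Contracting the arm vertices 1, ..., k-2 gives the centre of the bowtie. It forms one triangle
    with 0 and k, and another with the last arm vertex k-1 and the new vertex. *)
Lemma delta_attach_bowtie : 2 < k -> ~~ T 0 -> ~~ T k ->
  T k.-1 -> T k.-2 -> (forall i, i.+2 < k -> ~~ T i) -> False.
Proof.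
move=> k3 T0 Tk T1 T2 Tlow.
pose h i := if i == k.+1 then 4 else if i == k then 2 else if i == k.-1 then 3 else
  if i == 0 then 1 else 0.
have ends := (delta_attach_r, delta_attach_l, delta_attach_old).
have h1 : h k.+1 = 4 by rewrite /h eqxx.
have h2 : h k = 2 by rewrite /h ltn_eqF // eqxx.
have h3 : h k.-1 = 3 by rewrite /h eqxx !ifF //; clear -k3; lia.
have h4 : h 0 = 1 by rewrite /h !ifF //; clear -k3; lia.
have h5 i : 0 < i < k.-1 -> h i = 0.
  by move=> ik; rewrite /h !ifF //; clear -k3 ik; lia.
have hP i : i < k.+2 -> [\/ h i = 4 /\ i = k.+1, h i = 2 /\ i = k, h i = 3 /\ i = k.-1 |
    (h i = 1 /\ i = 0) \/ (h i = 0 /\ 0 < i < k.-1)].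
  move=> ik; rewrite /h; case: eqP => [|/eqP i1]; first by constructor 1.
  case: eqP => [|/eqP i2]; first by constructor 2.
  case: eqP => [|/eqP i3]; first by constructor 3.
  case: eqP => [|/eqP i4]; first by constructor 4; left.
  by constructor 4; right; split=> //; clear -ik i1 i2 i3 i4; lia.
have [|i j|c d|i j ik jk _ _|g] := @embeds_model _ e e_sym _ R _ 5 bowtie h emb;
  last exact: (factored_no_obstruction e_sym facA (m := 5) (E := bowtie)).
- case=> [|[|[|[|[|//]]]]] _.
  + by exists 1; [|apply: h5]; clear -k3; lia.
  + by exists 0.
  + by exists k.
  + by exists k.-1 => //; clear -k3; lia.
  + by exists k.+1.
- move=> ij jk hij _; have ik : i < k.+2 by apply: ltn_trans jk.
  case: (hP i ik) => [[hi iE]|[hi iE]|[hi iE]|[[hi iE]|[hi iE]]];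
    move: hij; rewrite hi;
    case: (hP j jk) => [[hj jE]|[hj jE]|[hj jE]|[[hj jE]|[hj jE]]]; rewrite hj // => _;
    try by [clear -ij iE jE; lia].
  split; first by apply: h5; clear -ij iE jE; lia.
  rewrite delta_attach_old /delta_nat /delta_edge; clear -ij iE jE; lia.
- rewrite /bowtie !inE => /or4P [/eqP [-> ->]|/eqP [-> ->]|/eqP [-> ->]|/orP[|/orP[]] /eqP [-> ->]].
  + exists 1, 0; split=> //; [apply: h5|rewrite delta_attach_old /delta_nat /delta_edge];
      clear -k3; lia.
  + exists 1, k; split=> //; [apply: h5|rewrite delta_attach_old /delta_nat /delta_edge];
      clear -k3; lia.
  + exists 0, k; split=> //; rewrite delta_attach_old /delta_nat /delta_edge; clear -k3; lia.
  + exists k.-2, k.-1; split=> //; try (by clear -k3; lia).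
      by apply: h5; clear -k3; lia.
    by rewrite delta_attach_old /delta_nat /delta_edge; clear -k3; lia.
  + exists k.-2, k.+1; split=> //; try (by clear -k3; lia).
      by apply: h5; clear -k3; lia.
    by rewrite delta_attach_r //; clear -k3; lia.
  + exists k.-1, k.+1; split=> //; try (by clear -k3; lia).
    by rewrite delta_attach_r //; clear -k3; lia.
have k3' : 0 < k.-1 by clear -k3; lia.
case: (hP i ik) => [[-> ->]|[-> ->]|[-> ->]|[[-> ->]|[-> iE]]];
  case: (hP j jk) => [[-> ->]|[-> ->]|[-> ->]|[[-> ->]|[-> jE]]] //= _;
  rewrite ?delta_attach_r ?delta_attach_l ?leq_pred // ?(negPf T0) ?(negPf Tk) //.
all: rewrite delta_attach_old ?leq_pred // /delta_nat /delta_edge; clear -k3; lia.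
Qed.

End GrowthDelta.

(** * Classification of factored connected graphs *)

Section Classification.

Variables (n : nat) (e : rel 'I_n).
Hypotheses (e_sym : symmetric e) (e_irr : irreflexive e) (facA : factored (CSA e)).

(** Deleting k or 0 leaves an induced path, 0, 1, ..., k-1 or k, 1, ..., k-1, to which the results
    on paths apply. A neighbour among 0 and k leads to a bull, unless k = 2, where the new vertex is
    a pendant of the triangle. Otherwise all neighbours lie at the far end of the arm; two of them
    give a bowtie, and a single one prolongs the arm. *)
Lemma delta_grows k T f i0 : 1 < k ->
  embeds e k.+2 (attach k.+1 (delta_nat k) T) f -> i0 <= k -> T i0 ->
  exists f', embeds e k.+2 (delta_nat k.+1) f'.
Proof.
move=> k2 emb i0k Ti0.
have [T0k T10k] := delta_attach_triangle e_sym facA k2 emb.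
have emb0 : embeds e k.+1 (attach k path_nat T) (f \o fun i => if i == k then k.+1 else i).
  apply: (embeds_comp emb) => [i|i j|i j i_lt j_lt].
  - by clear; case: eqP; lia.
  - by clear; case: eqP; case: eqP; lia.
  have [->|iE] := eqVneq i k; have [->|jE] := eqVneq j k.
  - by rewrite !attach_new.
  - by rewrite !attach_l //; clear -j_lt jE; lia.
  - by rewrite !attach_r //; clear -i_lt iE; lia.
  - by rewrite !attach_old ?/delta_nat ?/delta_edge ?/path_nat //; clear -i_lt j_lt iE jE; lia.
(* Neighbourhood of the new vertex on the path k, 1, ..., k-1, where k takes the number 0. *)
pose Tk i := if i == 0 then T k else T i.
have embk : embeds e k.+1 (attach k path_nat Tk)
    (f \o fun i => if i == 0 then k else if i == k then k.+1 else i).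
  apply: (embeds_comp emb) => [i|i j|i j i_lt j_lt].
  - by clear; case: (i =P 0); case: (i =P k); lia.
  - clear; case: (i =P 0); case: (i =P k); case: (j =P 0); case: (j =P k); lia.
  have [iE|iE] := eqVneq i k; have [jE|jE] := eqVneq j k; rewrite ?iE ?jE.
  - have -> : (k == 0) = false by clear -k2; lia.
    by rewrite !attach_new.
  - have -> : (k == 0) = false by clear -k2; lia.
    have jk : j < k by clear -j_lt jE; lia.
    rewrite [attach k _ _ _ _]attach_l // /Tk.
    by case: eqP => _; rewrite attach_l //; clear -jk; lia.
  - have -> : (k == 0) = false by clear -k2; lia.
    have ik : i < k by clear -i_lt iE; lia.
    rewrite [attach k _ _ _ _]attach_r // /Tk.
    by case: eqP => _; rewrite attach_r //; clear -ik; lia.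
  - have ik : i < k by clear -i_lt iE; lia.
    have jk : j < k by clear -j_lt jE; lia.
    rewrite [attach k _ _ _ _]attach_old //.
    case: (i =P 0) => iz; case: (j =P 0) => jz; rewrite attach_old;
      try (by clear -k2 ik jk; lia);
      rewrite /delta_nat /delta_edge /path_nat; clear -k2 ik jk iz jz; lia.
have end_grows a b : ((a, b) == (0, k)) || ((a, b) == (k, 0)) -> T a ->
    exists f', embeds e k.+2 (delta_nat k.+1) f'.
  move=> ab Ta.
  have nTb : ~~ T b.
    by move: T0k; case/orP: ab => /eqP [aE bE]; move: Ta; rewrite aE bE => ->; rewrite ?andbT.
  have nT1 : ~~ T 1.
    by move: T10k; case/orP: ab => /eqP [aE _]; move: Ta; rewrite aE => ->; rewrite ?orbT andbT.
  have [k3|k3] := ltnP 2 k.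
    (* If [T 2] held, [T] would agree with [T a] at distance two along the path that starts at [a],
       against [path_attach]. *)
    exfalso; apply: (delta_attach_bull e_sym facA k2 emb ab) => //; apply/negP => T2.
    case/orP: ab => /eqP [aE _]; rewrite aE in Ta.
      have /negP[] : ~~ T 0 by apply: (path_attach e_sym facA emb0 _ k3 (etrans Ta (esym T2))).
      exact: Ta.
    have /negP[] : ~~ Tk 0 by apply: (path_attach (a := 0) (b := 2) e_sym facA embk _ k3 (etrans Ta (esym T2))).
    exact: Ta.
  have kE : k = 2 by clear -k2 k3; lia.
  (* The pendant vertex has to hang from the vertex numbered 1, so [a] takes that number. *)
  exists (f \o nth 0 [:: 1; a; 3; b]); move: emb; rewrite kE => emb4.
  move: Ta (negPf nTb) (negPf nT1); rewrite kE in ab.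
  case/orP: ab => /eqP [-> ->] Ta Tb T1; apply: (embeds_comp emb4);
    try (by case=> [|[|[|[|//]]]]); try (by case=> [|[|[|[|//]]]] [|[|[|[|//]]]]);
    by case=> [|[|[|[|//]]]] [|[|[|[|//]]]] _ _; rewrite /attach /= ?Ta ?Tb ?T1.
have [T0|T0] := boolP (T 0); first by apply: (end_grows 0 k); rewrite ?eqxx.
have [TkT|TkF] := boolP (T k); first by apply: (end_grows k 0); rewrite ?eqxx ?orbT.
have i0E : i0 < k.
  by rewrite ltn_neqAle i0k andbT; apply: contraTneq Ti0 => ->.
have [[] |[T1 Tlow]] := path_attach_end e_sym facA (ltnW k2) emb0 i0E Ti0.
  by rewrite (negPf T0).
have [/andP [k3 T2]|T2] := boolP ((2 < k) && T k.-2).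
  by case: (delta_attach_bowtie e_sym facA emb k3 T0 TkF T1 T2 Tlow).
have TE x : x <= k -> T x = (k == x.+1).
  move=> xk; have [->|x0] := eqVneq x k.
    by rewrite (negPf TkF); clear; lia.
  have [->|x1] := eqVneq x k.-1; first by rewrite T1; clear -k2; lia.
  have [->|x3] := eqVneq x 0; first by rewrite (negPf T0); clear -k2; lia.
  have [x2|x2] := eqVneq x k.-2.
    move: T2; have -> : 2 < k by clear -x3 x2; lia.
    by rewrite -x2 /= => /negPf ->; clear -x2 x3; lia.
  by rewrite (negPf (Tlow x _)); clear -x0 x1 x2 xk; lia.
(* The apex always carries the largest number: it moves to [k.+1], and the new vertex ends the arm
   at [k]. *)
exists (f \o fun i => if i == k then k.+1 else if i == k.+1 then k else i).
apply: (embeds_comp emb) => [i|i j|i j i_lt j_lt].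
- by clear; case: (i =P k); case: (i =P k.+1); lia.
- by clear; case: (i =P k); case: (i =P k.+1); case: (j =P k); case: (j =P k.+1); lia.
have cases x : x < k.+2 -> [\/ x = k, x = k.+1 | x < k].
  move=> xk; have [x1|[x1|x1]] : x = k \/ x = k.+1 \/ x < k by clear -xk; lia.
  - by constructor 1.
  - by constructor 2.
  - by constructor 3.
have kSk : (k.+1 == k) = false by clear; lia.
case: (cases i i_lt) => [->|->|iE]; case: (cases j j_lt) => [->|->|jE];
  rewrite ?eqxx ?kSk ?[i == k]ltn_eqF ?[j == k]ltn_eqF ?[i == k.+1]ltn_eqF ?[j == k.+1]ltn_eqF;
  rewrite ?attach_new ?attach_l ?attach_r ?attach_old ?TE //;
  rewrite /delta_nat /delta_edge; first [clear -k2; lia | clear -k2 iE; lia | clear -k2 jE; lia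
    | clear -k2 iE jE; lia].
Qed.

Theorem factored_embeds : connected_graph e ->
  (exists f, embeds e n path_nat f) \/
  (exists k f, [/\ 1 < k, n = k.+1 & embeds e n (delta_nat k) f]).
Proof.
move=> conn; have /andP [/set0Pn [x0 _] _] := conn.
have n0 : 0 < n by apply: leq_ltn_trans (ltn_ord x0).
suff all_K K : 0 < K -> K <= n -> (exists f, embeds e K path_nat f) \/
    (exists k f, [/\ 1 < k, K = k.+1 & embeds e K (delta_nat k) f]) by exact: all_K.
case: K => // K _; elim: K => [|K IHK] Kn.
  left; exists (fun=> x0); split=> i j; rewrite !ltnS !leqn0 => /eqP -> /eqP -> //.
have attach_vertex r f : embeds e K.+1 r f ->
    exists T f' i0, [/\ embeds e K.+2 (attach K.+1 r T) f', i0 < K.+1 & T i0].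
  move=> emb; pose S := [set f i | i : 'I_K.+1].
  have /(induced_connected_cutP _ e_sym) [_ cut] := conn.
  have [|||x [y [/imsetP [i _ ->]]]] := cut S.
  - by rewrite subsetT.
  - by apply/set0Pn; exists (f 0); apply/imsetP; exists ord0.
  - apply: contraTneq Kn => ST; rewrite -leqNgt.
    have <- : #|S| = n by rewrite ST cardsT card_ord.
    by rewrite -[leqRHS]card_ord leq_imset_card.
  rewrite !inE andbT => yS efy.
  exists (fun i => e y (f i)), (fun i => if i == K.+1 then y else f i), i.
  split=> //; last by rewrite e_sym.
  apply: embeds_attach => // j jK; apply: contraNneq yS => <-.
  by apply/imsetP; exists (Ordinal jK).
have [[f emb]|[k [f [k2 KE emb]]]] := IHK (ltnW Kn).
  have [T [f' [i0 [emb' i0K Ti0]]]] := attach_vertex _ _ emb.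
  have [g [embg|[K1 embg]]] := path_grows e_sym facA (ltn0Sn K) emb' i0K Ti0.
    by left; exists g.
  by right; exists K.+1, g.
have [T [f' [i0 [emb' i0K Ti0]]]] := attach_vertex _ _ emb.
move: KE emb' i0K => [->] emb' i0K.
have [g embg] := delta_grows k2 emb' i0K Ti0.
by right; exists k.+1, g; split=> //; apply: ltnW.
Qed.

Lemma embeds_graph_iso (r : rel nat) f : embeds e n r f ->
  graph_iso e (fun x y : 'I_n => r x y).
Proof.
move=> [f_inj f_edge].
have f'_inj : injective (fun i : 'I_n => f i).
  by move=> i j /f_inj ij; apply/val_inj/ij.
have [g fK gK] := injF_bij f'_inj.
exists g; split; first by exists (fun i : 'I_n => f i).
by move=> x y; rewrite -{1}(gK x) -{1}(gK y) f_edge.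
Qed.

End Classification.

(** * A criterion for nice partitions *)

Local Open Scope ring_scope.

(** The blocks are the fibres of [lab]. Labels below n bound their number by n, so [free_of_forms]
    reduces independence of a transversal to the absence of nonzero common zeros. *)
Lemma factored_of_labels n (A : {set {set 'I_n}}) (lab : {set 'I_n} -> nat) :
  (forall I, I \in A -> (lab I < n)%N) ->
  (forall u, (forall I, I \in A ->
      exists J, [/\ J \in A, lab J = lab I & coord_sum u J = 0]) -> u = 0) ->
  (forall B : {set {set 'I_n}}, (exists2 I, I \in A & (flat B <= hyp I)%MS) ->
     exists I, [/\ I \in A, (flat B <= hyp I)%MS &
       forall J, J \in A -> lab J = lab I -> (flat B <= hyp J)%MS -> J = I]) ->
  factored A.
Proof.
move=> lab_lt indep sing; exists (preim_partition lab A).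
have partP := preim_partitionP lab A.
have [/eqP covP trivP P0] := and3P partP.
have blockE C I : C \in preim_partition lab A -> I \in C ->
    C = [set J in A | lab I == lab J].
  case/imsetP => J JA -> /=; rewrite inE => /andP [IA /eqP JI].
  by apply/setP => L; rewrite !inE JI.
split=> // [F FP|B BA nfull].
- rewrite (map_comp (@form n) F); apply: free_of_forms => [|u uF].
    rewrite size_map -cardE -[leqRHS]card_ord.
    apply: leq_trans (leq_imset_card (fun l : 'I_n => [set I in A | l == lab I :> nat]) 'I_n).
    apply: subset_leq_card; apply/subsetP => C /imsetP [I IA ->].
    by apply/imsetP; exists (Ordinal (lab_lt I IA)).
  apply: indep => I IA; pose C := pblock (preim_partition lab A) I.
  have CP : C \in preim_partition lab A by rewrite pblock_mem ?covP.
  have FC := FP C CP.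
  exists (F C); split.
  + by rewrite -covP; apply/bigcupP; exists C.
  + have IC : I \in C by rewrite mem_pblock covP.
    by move: FC; rewrite (blockE C I CP IC) inE => /andP [_ /eqP].
  + by apply: uF; apply: map_f; rewrite mem_enum.
have [I IA] : exists2 I, I \in A & (flat B <= hyp I)%MS.
  have [B0|/set0Pn [I IB]] := eqVneq B set0.
    by case/negP: nfull; rewrite /flat B0 big_set0.
  by exists I; [exact: subsetP IB|exact: flat_sub].
move=> XI; have [|L [LA XL Lsing]] := sing B; first by exists I.
pose C := pblock (preim_partition lab A) L.
have CP : C \in preim_partition lab A by rewrite pblock_mem ?covP.
have LC : L \in C by rewrite mem_pblock covP.
exists C => //; apply/eqP/cards1P; exists L; apply/setP => J; rewrite !inE.
apply/andP/eqP => [[JC XJ]|-> //].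
by move: JC; rewrite (blockE C L CP LC) inE => /andP [JA /eqP lJ]; apply: Lsing.
Qed.

(** Connected sets are coded by a flag for the apex and two positions on the path, so that the
    conditions on the partition become conditions on [i] and [j]. *)
Lemma factored_of_codes n (A : {set {set 'I_n}}) (valid : bool -> nat -> nat -> bool)
    (st : bool -> nat -> nat -> {set 'I_n}) (lab : bool -> nat -> nat -> nat) :
  (forall s i j, valid s i j -> [/\ (i <= n)%N, (j <= n)%N & (lab s i j < n)%N]) ->
  (forall s i j s' i' j', valid s i j -> valid s' i' j' -> st s i j = st s' i' j' ->
     lab s i j = lab s' i' j') ->
  (forall I, I \in A <-> exists s i j, valid s i j /\ I = st s i j) ->
  (forall u, (forall s i j, valid s i j -> exists s' i' j',
      [/\ valid s' i' j', lab s' i' j' = lab s i j & coord_sum u (st s' i' j') = 0]) ->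
     u = 0) ->
  (forall (B : {set {set 'I_n}}) (z := fun s i j => (flat B <= hyp (st s i j))%MS),
     (exists s i j, valid s i j && z s i j) ->
     exists s i j, [/\ valid s i j, z s i j & forall s' i' j', valid s' i' j' ->
       lab s' i' j' = lab s i j -> z s' i' j' -> st s' i' j' = st s i j]) ->
  factored A.
Proof.
move=> bounded lab_st memA indep sing.
pose labS (I : {set 'I_n}) := if [pick c : bool * 'I_n.+1 * 'I_n.+1 |
    valid c.1.1 c.1.2 c.2 && (I == st c.1.1 c.1.2 c.2)] is Some c
  then lab c.1.1 c.1.2 c.2 else 0%N.
have labSE s i j : valid s i j -> labS (st s i j) = lab s i j.
  move=> v; rewrite /labS; case: pickP => [[[s' i'] j'] /= /andP [v' /eqP E]|none].
    exact/esym/lab_st.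
  have [iN jN _] := bounded _ _ _ v.
  by have := none (s, Ordinal (iN : i < n.+1)%N, Ordinal (jN : j < n.+1)%N);
    rewrite /= v eqxx.
have stA s i j : valid s i j -> st s i j \in A by move=> v; apply/memA; exists s, i, j.
apply: (@factored_of_labels _ _ labS).
- by move=> I /memA [s [i [j [v ->]]]]; rewrite labSE //; have [] := bounded _ _ _ v.
- move=> u uA; apply: indep => s i j v.
  have [J [/memA [s' [i' [j' [v' ->]]]]]] := uA _ (stA s i j v).
  by rewrite !labSE // => ? ?; exists s', i', j'.
move=> B [I /memA [s [i [j [v ->]]]] z].
have [|s' [i' [j' [v' z' only]]]] := sing B; first by exists s, i, j; rewrite v.
exists (st s' i' j'); split=> //; first exact: stA.
by move=> J /memA [s2 [i2 [j2 [v2 ->]]]]; rewrite !labSE //; apply: only.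
Qed.

Local Close Scope ring_scope.

(** * Nice partitions for paths and paths with a triangle *)

Lemma coord_sum_disjointU n (u : 'rV[rat]_n) (I J : {set 'I_n}) : [disjoint I & J] ->
  coord_sum u (I :|: J) = (coord_sum u I + coord_sum u J)%R.
Proof. by move=> dIJ; rewrite /coord_sum -bigU //; apply: eq_bigl => x; rewrite !inE. Qed.

Lemma coord_sum1 n (u : 'rV[rat]_n) x : coord_sum u [set x] = u 0%R x.
Proof. by rewrite /coord_sum big_set1. Qed.

Lemma connected_cut n (e : rel 'I_n) (I : {set 'I_n}) (Q : pred 'I_n) x y : symmetric e ->
  induced_connected e I -> x \in I -> Q x -> y \in I -> ~~ Q y ->
  exists x' y', [/\ x' \in I, Q x', y' \in I, ~~ Q y' & e x' y'].
Proof.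
move=> e_sym /(induced_connected_cutP _ e_sym) [_ cut] xI Qx yI Qy.
have [|||x' [y' []]] := cut [set z in I | Q z].
- by apply/subsetP => z; rewrite inE => /andP [].
- by apply/set0Pn; exists x; rewrite inE xI.
- by apply/eqP => /setP/(_ y); rewrite inE yI (negPf Qy).
rewrite !inE => /andP [x'I Qx'] /andP [Qy' y'I] exy.
by exists x', y'; split=> //; move: Qy'; rewrite y'I.
Qed.

Section Segments.

Variables (n : nat) (f g : 'I_n -> 'I_n).
Hypotheses (fK : cancel f g) (gK : cancel g f).

(** Half-open, so that coordinate sums over segments are differences of prefix sums, with prefix sum
    0 at position 0. *)
Definition seg (i j : nat) : {set 'I_n} := [set x | i <= f x < j].

Definition prefix_sum (u : 'rV[rat]_n) (j : nat) : rat := coord_sum u (seg 0 j).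

Lemma coord_sum_seg u i j : i <= j ->
  coord_sum u (seg i j) = (prefix_sum u j - prefix_sum u i)%R.
Proof.
move=> ij; rewrite /prefix_sum (_ : seg 0 j = seg 0 i :|: seg i j); last first.
  apply/setP => x; rewrite !inE; clear -ij; lia.
rewrite coord_sum_disjointU; first by rewrite [RHS]addrC addKr.
by rewrite disjoint_subset; apply/subsetP => x; rewrite !inE; clear; lia.
Qed.

Lemma prefix_sum0 u : prefix_sum u 0 = 0%R.
Proof.
by rewrite /prefix_sum (_ : seg 0 0 = set0) ?/coord_sum ?big_set0 //; apply/setP => x; rewrite !inE.
Qed.

Lemma seg1 x : seg (f x) (f x).+1 = [set x].
Proof.
apply/setP => y; rewrite !inE ltnS -eqn_leq; apply/eqP/eqP => [/val_inj/(can_inj fK) -> //|-> //].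
Qed.

Lemma prefix_sum_eq0 u : (forall j, j <= n -> prefix_sum u j = 0%R) -> u = 0%R.
Proof.
move=> u0; apply/rowP => x; rewrite mxE -coord_sum1 -seg1 coord_sum_seg //.
by rewrite !u0 ?subrr // ltnW.
Qed.

Lemma mem_seg i j m (mn : m < n) : (g (Ordinal mn) \in seg i j) = (i <= m < j).
Proof. by rewrite inE gK. Qed.

Lemma seg_inj i j i' j' : i < j <= n -> i' < j' <= n -> seg i j = seg i' j' ->
  i = i' /\ j = j'.
Proof.
move=> ij ij' E; have mem m : m < n -> (i <= m < j) = (i' <= m < j').
  by move=> mn; rewrite -!(mem_seg _ _ mn) E.
have := mem i; have := mem i'; have := mem j.-1; have := mem j'.-1.
by clear -ij ij'; lia.
Qed.

Variables (e : rel 'I_n) (K : nat).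
Hypotheses (e_sym : symmetric e)
  (e_path : forall x y, f x < K -> f y < K -> e x y = path_nat (f x) (f y)).

Lemma seg_connected i j : i < j -> j <= K -> K <= n -> induced_connected e (seg i j).
Proof.
move=> ij jK Kn; elim: j ij jK => // j IHj; rewrite ltnS leq_eqVlt => /predU1P [->|ij] jK.
  have jn : j < n by apply: leq_trans Kn.
  have -> : seg j j.+1 = [set g (Ordinal jn)] by rewrite -seg1 gK.
  exact: induced_connected1.
have jn : j < n by apply: leq_trans Kn.
have jn' : j.-1 < n by clear -jn; lia.
have -> : seg i j.+1 = seg i j :|: [set g (Ordinal jn)].
  by rewrite -seg1 gK; apply/setP => x; rewrite !inE /=; clear -ij; lia.
apply: (@induced_connectedU _ e _ _ (g (Ordinal jn')) (g (Ordinal jn))) => //.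
- by apply: IHj => //; apply: ltnW.
- exact: induced_connected1.
- by rewrite mem_seg; clear -ij; lia.
- by rewrite set11.
- by rewrite e_path ?gK /path_nat /=; clear -ij jK; lia.
Qed.

(* Q is meant for the apex of the triangle, which lies off the path. *)
Lemma connected_no_gap (I : {set 'I_n}) (Q : pred 'I_n) m x y :
  induced_connected e I ->
  (forall z, z \in I -> ~~ Q z -> f z < K) ->
  (forall z t, z \in I -> t \in I -> Q z -> ~~ Q t -> e z t -> f t <= m) ->
  x \in I -> Q x || (f x < m) -> y \in I -> ~~ Q y -> m <= f y ->
  exists2 z, z \in I & f z = m :> nat.
Proof.
move=> conI QK Qlow xI Qx yI Qy my.
have [/existsP [z /and3P [zI _ /eqP fz]]|/existsPn nom] :=
  boolP [exists z, [&& z \in I, ~~ Q z & f z == m :> nat]]; first by exists z.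
have [|x' [y' [x'I Qx' y'I]]] :=
  @connected_cut _ e I (fun z => Q z || (f z < m)) x y e_sym conI xI Qx yI.
  by rewrite negb_or Qy -leqNgt.
rewrite negb_or -leqNgt => /andP [Qy' my'] exy.
have y'm : f y' != m :> nat by have := nom y'; rewrite y'I Qy'.
have [Qx2|Qx2] := boolP (Q x').
  have := Qlow x' y' x'I y'I Qx2 Qy' exy.
  by rewrite leq_eqVlt (negPf y'm) ltnNge my'.
move: Qx'; rewrite (negPf Qx2) /= => x'm.
by move: exy; rewrite e_path ?QK // /path_nat; clear -x'm my' y'm; lia.
Qed.

Lemma connected_seg (I : {set 'I_n}) : induced_connected e I ->
  (forall z, z \in I -> f z < K) -> exists i j, i < j <= K /\ I = seg i j.
Proof.
move=> conI IK; have /andP [/set0Pn [x0 x0I] _] := conI.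
have ex_low : exists m, [exists x in I, f x == m :> nat].
  by exists (f x0); apply/exists_inP; exists x0.
have ub m : [exists x in I, f x == m :> nat] -> m <= n.
  by case/exists_inP => x _ /eqP <-; apply: ltnW.
case: (ex_minnP ex_low) => i /exists_inP [x xI /eqP xi] imin.
case: (ex_maxnP ex_low ub) => j /exists_inP [y yI /eqP yj] jmax.
have between z : z \in I -> i <= f z <= j.
  by move=> zI; rewrite imin ?jmax //; apply/exists_inP; exists z.
exists i, j.+1; split.
  by have := between x xI; have := IK y yI; rewrite xi yj; clear; lia.
apply/setP => z; rewrite inE ltnS; apply/idP/idP => [|/andP [iz zj]]; first exact: between.
have [|zi] := eqVneq (f z : nat) i.
  by rewrite -xi => /val_inj/(can_inj fK) ->.
have [t tI] : exists2 t, t \in I & f t = f z :> nat.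
  apply: (@connected_no_gap I pred0 (f z) x y conI (fun t tI _ => IK t tI) _ xI _ yI) => //=.
      by rewrite xi; clear -iz zi; lia.
  by rewrite yj.
by move/val_inj/(can_inj fK) => <-.
Qed.

End Segments.

(** In the prefix sums p_0 = 0, p_1, ..., p_n this is the braid arrangement. A zero of a transversal
    satisfies p_j = p_i with some i < j for each j > 0, so every p_j is 0 by induction. At the least
    [j] for which p_j equals an earlier p_i on the flat, that i is unique: two of them would give an
    equality with a smaller upper index. *)
Lemma path_factored n (e : rel 'I_n) : symmetric e -> graph_iso e (@path_rel n) ->
  factored (CSA e).
Proof.
move=> e_sym [f [[g fK gK] e_f]].
have e_path x y : f x < n -> f y < n -> e x y = path_nat (f x) (f y) by rewrite e_f.
pose valid (s : bool) i j := ~~ s && (i < j <= n).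
(* Labels must lie below n, while the upper positions of valid codes run from 1 to n; hence
   [j.-1]. *)
apply: (@factored_of_codes n _ valid (fun _ => seg f) (fun _ _ j => j.-1)).
- by move=> s i j; rewrite /valid; clear; split; lia.
- by move=> s i j s' i' j' /andP [_ v] /andP [_ v'] /(seg_inj gK v v') [_ ->].
- move=> I; split=> [|[s [i [j [/andP [_ /andP [ij jn]] ->]]]]]; rewrite inE.
    move=> conI; have [|i [j [ij ->]]] := connected_seg fK e_sym e_path conI.
      by move=> z _; apply: ltn_ord.
    by exists false, i, j.
  exact: (seg_connected fK gK e_sym e_path).
- move=> u uZ; apply: (prefix_sum_eq0 fK).
  elim/ltn_ind => -[|j] IHj jn; first exact: prefix_sum0.
  have [|s [i' [j' [/andP [_ /andP [ij' j'n]] j'j]]]] := uZ false 0 j.+1 _.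
    by rewrite /valid.
  have {j'j} j'E : j' = j.+1 by clear -j'j ij'; lia.
  rewrite j'E in ij' *; rewrite coord_sum_seg ?(ltnW ij') // (IHj i') ?subr0 //.
  by clear -ij' jn; lia.
move=> B z [s0 [i0 [j0 /andP [/andP [_ /andP [ij0 jn0]] z0]]]].
have ex_j : exists j, [exists i : 'I_j, (flat B <= hyp (seg f i j))%MS].
  by exists j0; apply/existsP; exists (Ordinal ij0).
case: (ex_minnP ex_j) => j /existsP [i zij] jmin.
have jn : j <= n by apply: leq_trans jn0; apply: jmin; apply/existsP; exists (Ordinal ij0).
exists false, i, j; split=> //; first by rewrite /valid ltn_ord.
move=> s i' j' /andP [_ /andP [ij' jn']] j'j; rewrite /z.
have -> : j' = j by clear -j'j ij' i; case: i => /= ? ?; lia.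
have {ij' jn'} ij' : i' < j by move: ij' j'j; clear -i; case: i => /= ? ?; lia.
move: zij => /flat_sub_hypP zij /flat_sub_hypP zij'.
have eqp u : (u <= flat B)%MS -> prefix_sum f u i = prefix_sum f u i'.
  move=> uB; have := zij u uB; have := zij' u uB.
  rewrite !coord_sum_seg ?(ltnW ij') ?(ltnW (ltn_ord i)) //.
  by move=> /eqP; rewrite subr_eq0 => /eqP <- /eqP; rewrite subr_eq0 => /eqP ->.
have lt_absurd a b : a < b -> b < j ->
    (forall u, (u <= flat B)%MS -> prefix_sum f u b = prefix_sum f u a) -> False.
  move=> ab bj ab_eq; suff /jmin : [exists i : 'I_b, (flat B <= hyp (seg f i b))%MS].
    by rewrite leqNgt bj.
  apply/existsP; exists (Ordinal ab); apply/flat_sub_hypP => u uB.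
  by rewrite coord_sum_seg ?ab_eq ?subrr // ltnW.
have [ii'|ii'|-> //] := ltngtP i i'.
- by case: (lt_absurd i i') => // u uB; rewrite eqp.
- by case: (lt_absurd i' i) => // u uB; rewrite eqp.
Qed.

Lemma min_or_none (P : pred nat) k :
  (exists j, [/\ j <= k, P j & forall i, i < j -> ~~ P i]) \/ (forall j, j <= k -> ~~ P j).
Proof.
have [/existsP [j Pj]|/existsPn none] := boolP [exists j : 'I_k.+1, P j].
  have exP : exists j, P j by exists j.
  case: (ex_minnP exP) => m Pm mmin; left; exists m; split=> // [|i].
    by apply: leq_trans (mmin j Pj) _; rewrite -ltnS.
  by apply: contraTN => /mmin; rewrite -leqNgt.
by right=> j jk; apply: (none (Ordinal (jk : j < k.+1))).
Qed.

(** * The partition for a path with a triangle *)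

Section DeltaFactored.

Variables (k : nat) (e : rel 'I_k.+1) (f g : 'I_k.+1 -> 'I_k.+1).
Hypotheses (k2 : 1 < k) (e_sym : symmetric e) (fK : cancel f g) (gK : cancel g f)
  (e_f : forall x y, e x y = delta_nat k (f x) (f y)).

Let b : 'I_k.+1 := g ord_max.

Lemma f_apex : f b = k :> nat.
Proof. by rewrite /b gK. Qed.

Lemma apexE x : (x == b) = (f x == k :> nat).
Proof.
apply/eqP/eqP => [->|fx]; first exact: f_apex.
by apply: (can_inj fK); apply: val_inj; rewrite /= fx f_apex.
Qed.

Lemma f_lt_apex x : x != b -> f x < k.
Proof. by rewrite apexE => fx; have := ltn_ord (f x); rewrite ltnS leq_eqVlt (negPf fx). Qed.

Lemma delta_path x y : f x < k -> f y < k -> e x y = path_nat (f x) (f y).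
Proof. by move=> xk yk; rewrite e_f /delta_nat /delta_edge /path_nat; clear -xk yk; lia. Qed.

Lemma apex_edge y : e b y = (f y <= 1).
Proof.
rewrite e_f f_apex /delta_nat /delta_edge; have := ltn_ord (f y).
by clear -k2; lia.
Qed.

Definition delta_set (s : bool) (i j : nat) : {set 'I_k.+1} :=
  (if s then [set b] else set0) :|: seg f i j.

(** The apex sees only positions 0 and 1, so a segment joined to it starts there. The apex alone has
    the code with both positions 0. *)
Definition delta_valid (s : bool) (i j : nat) : bool :=
  if s then ((i == 0) && (j == 0)) || [&& i <= 1, i < j & j <= k] else i < j <= k.

(** For j > 1 the initial segment of length j crosses the set made of the apex and the positions 1,
    ..., j-1, so the rank two condition keeps the two in different blocks. This is why initial
    segments leave block j and join the apex in block 0. Block 1 is left with the single form b +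
    p_1. *)
Definition delta_label (s : bool) (i j : nat) : nat :=
  if s then j else if i == 0 then 0 else j.

Lemma apex_notin_seg i j : j <= k -> b \notin seg f i j.
Proof. by move=> jk; rewrite inE f_apex; clear -jk; lia. Qed.

Lemma apex_in_delta_set s i j : j <= k -> (b \in delta_set s i j) = s.
Proof.
move=> jk; rewrite inE (negPf (apex_notin_seg i jk)) orbF.
by case: s; rewrite ?set11 ?in_set0.
Qed.

Lemma coord_sum_delta_set u s i j : i <= j <= k ->
  coord_sum u (delta_set s i j) =
  ((if s then u 0 b else 0) + prefix_sum f u j - prefix_sum f u i)%R.
Proof.
move=> /andP [ij jk]; rewrite /delta_set coord_sum_disjointU; last first.
  case: s; rewrite ?disjoints1 ?apex_notin_seg //.
  by rewrite -setI_eq0 set0I.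
rewrite coord_sum_seg // addrA; congr (_ + _ - _)%R.
by case: s; rewrite ?coord_sum1 // /coord_sum big_set0.
Qed.

Lemma delta_label_set s i j s' i' j' : delta_valid s i j -> delta_valid s' i' j' ->
  delta_set s i j = delta_set s' i' j' -> delta_label s i j = delta_label s' i' j'.
Proof.
move=> v v' E.
have jk : j <= k by move: v; rewrite /delta_valid; clear; case: s; lia.
have jk' : j' <= k by move: v'; rewrite /delta_valid; clear; case: s'; lia.
have ss' : s = s' by rewrite -(apex_in_delta_set s i jk) E apex_in_delta_set.
have mem m : m < k -> (i <= m < j) = (i' <= m < j').
  move=> mk; have mk' : m < k.+1 by apply: ltnW.
  have /setP/(_ (g (Ordinal mk'))) := E; rewrite !in_setU !mem_seg //.
  have notb l : (g (Ordinal mk') \in (if l then [set b] else set0)) = false.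
    by case: l; rewrite !inE ?apexE ?gK //= ltn_eqF.
  by rewrite !notb.
have := mem i; have := mem i'; have := mem j.-1; have := mem j'.-1.
move: v v'; rewrite -ss' /delta_valid /delta_label; clear.
by case: s; [lia|case: eqP; case: eqP; lia].
Qed.

(** If [b] lies in [I], its edges reach only positions 0 and 1, so all positions from 1 to the
    largest one in [I] are filled; whether 0 is filled decides the start [i]. *)
Lemma connected_delta_set I : I \in CSA e <->
  exists s i j, delta_valid s i j /\ I = delta_set s i j.
Proof.
rewrite inE; split=> [conI|[s [i [j [v ->]]]]].
  have [bI|bI] := boolP (b \in I); last first.
    have [z zI|i [j [ij ->]]] := connected_seg fK e_sym delta_path conI.
      by apply: f_lt_apex; apply: contraNneq bI => <-.
    by exists false, i, j; rewrite /delta_set set0U.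
  have [/eqP I1|I1] := boolP (I == [set b]).
    exists true, 0, 0; split=> //; rewrite I1 /delta_set.
    by apply/setP => x; rewrite !inE /= orbF.
  have [y0 y0I y0b] : exists2 y, y \in I & y != b.
    have /subsetPn [y yI] : ~~ (I \subset [set b]).
      by apply: contra I1 => Ib; rewrite eqEsubset Ib sub1set.
    by rewrite inE; exists y.
  pose P m := [exists x in I, (x != b) && (f x == m :> nat)].
  have exP : exists m, P m by exists (f y0); apply/exists_inP; exists y0; rewrite ?y0b /=.
  have ubP m : P m -> m <= k by case/exists_inP => x _ /andP [_ /eqP <-]; rewrite -ltnS.
  case: (ex_maxnP exP ubP) => j /exists_inP [y yI /andP [yb /eqP yj]] jmax.
  have jk : j < k by rewrite -yj f_lt_apex.
  have full m : 1 <= m -> m <= j -> exists2 z, z \in I & f z = m :> nat.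
    move=> m1 mj; apply: (@connected_no_gap _ f e k e_sym delta_path I (pred1 b) m b y) => //=.
    - by move=> z _; apply: f_lt_apex.
    - by move=> z t _ _ /eqP -> _; rewrite apex_edge => /leq_trans; apply.
    - by rewrite eqxx.
    - by rewrite yj.
  pose i := if g ord0 \in I then 0 else 1.
  exists true, i, j.+1; split.
    rewrite /delta_valid jk /i; case: ifP => [|/negbT g0] //=.
    rewrite ltnS andbT lt0n; apply: contraNneq g0 => j0.
    by rewrite (_ : ord0 = f y) ?fK //; apply: val_inj; rewrite /= yj.
  apply/setP => x; rewrite /delta_set !inE; have [->|xb] := eqVneq x b; first by rewrite bI.
  rewrite /= ltnS; apply/idP/andP => [xI|[ix xj]].
    split; last by apply: jmax; apply/exists_inP; exists x; rewrite ?xb /=.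
    rewrite /i; case: ifP => // /negP g0; rewrite lt0n; apply/eqP => fx0; apply: g0.
    by rewrite (_ : ord0 = f x) ?fK //; apply: val_inj.
  have [x0|x0] := eqVneq (f x : nat) 0.
    move: ix; rewrite x0 /i; case: ifP => // g0 _.
    by rewrite -(fK x) (_ : f x = ord0) //; apply: val_inj.
  have [|z zI] := full (f x) _ xj; first by rewrite lt0n.
  by move/val_inj/(can_inj fK) => <-.
have kk : k <= k.+1 by [].
have con0 i' j' : i' < j' -> j' <= k -> induced_connected e (seg f i' j').
  by move=> ij jk; apply: (seg_connected fK gK e_sym delta_path).
move: v; rewrite /delta_valid /delta_set; case: s => [/orP [/andP [/eqP -> /eqP ->]|]|].
- rewrite (_ : seg f 0 0 = set0) ?setU0; first exact: induced_connected1.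
  by apply/setP => x; rewrite !inE.
- move=> /and3P [i1 ij jk]; have ik : i < k.+1 by clear -i1 k2; lia.
  apply: (@induced_connectedU _ e _ _ b (g (Ordinal ik)) e_sym) => //.
  + exact: induced_connected1.
  + exact: con0.
  + by rewrite set11.
  + by rewrite mem_seg // leqnn.
  + by rewrite apex_edge gK /= i1 orbT.
- by rewrite set0U => /andP [ij jk]; apply: con0.
Qed.

(** Block 1 forces b = - p_1. By induction block j then gives p_j = p_1 or p_j = 2 p_1 for each j >
    0. Block 0 yields b = 0 or some p_j = 0, and either way p_1 = 0 because 2 is invertible. *)
Lemma delta_transversal_spans (u : 'rV[rat]_k.+1) :
  (forall s i j, delta_valid s i j -> exists s' i' j',
     [/\ delta_valid s' i' j', delta_label s' i' j' = delta_label s i j &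
         coord_sum u (delta_set s' i' j') = 0%R]) -> u = 0%R.
Proof.
move=> uZ.
have Z s i j : delta_valid s i j -> exists s' i' j',
     [/\ delta_valid s' i' j', delta_label s' i' j' = delta_label s i j &
       ((if s' then u 0 b else 0) + prefix_sum f u j' - prefix_sum f u i' = 0)%R].
  move=> /uZ [s' [i' [j' [v l]]]]; rewrite coord_sum_delta_set => [? |].
    by exists s', i', j'.
  by move: v; rewrite /delta_valid; clear; case: s'; lia.
have p0 := prefix_sum0 f u.
pose p := prefix_sum f u.
have b1 : (u 0 b + p 1 = 0)%R.
  have [|s [i [j [v l E]]]] := Z true 0 1; first by rewrite /delta_valid; clear -k2; lia.
  case: s v l E; rewrite /delta_valid /delta_label => v l.
    have -> : i = 0 by clear -v l; lia.
    by rewrite l p0 subr0.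
  by exfalso; move: v l; clear; case: eqP; lia.
have p12 j : 0 < j -> j <= k -> p j = p 1 \/ p j = (p 1 + p 1)%R.
  elim/ltn_ind: j => j IHj j0 jk.
  have [j1|j1] := eqVneq j 1; first by left; rewrite j1.
  have [|s [i [j' [v l E]]]] := Z true 0 j.
    by rewrite /delta_valid; clear -j0 jk; lia.
  case: s v l E; rewrite /delta_valid /delta_label => v l.
    rewrite l -/p; have [->|->] : i = 0 \/ i = 1 by clear -v l j0; lia.
      by rewrite /p p0 -/p => E; left; move: b1 E; lra.
    by move=> E; right; move: b1 E; lra.
  move: l; case: (i =P 0) => [_ l|/eqP i0 l]; first by rewrite -l in j0.
  rewrite l -/p add0r => /eqP; rewrite subr_eq0 => /eqP ->.
  by apply: IHj; clear -v l i0 jk; lia.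
have p1 : p 1 = 0%R.
  have [|s [i [j [v l E]]]] := Z true 0 0; first by rewrite /delta_valid.
  case: s v l E; rewrite /delta_valid /delta_label => v l.
    have [-> ->] : i = 0 /\ j = 0 by clear -v l; lia.
    by rewrite -/p => E; move: b1 E; lra.
  move: l; case: (i =P 0) => [i0 _|_ l]; last by rewrite l in v; move: v; clear; lia.
  rewrite i0 p0 -/p => E; have [||pj|pj] := p12 j; try (by clear -v i0; lia).
    by rewrite -pj; move: E; lra.
  by move: E; rewrite pj; lra.
have pk j : j <= k -> p j = 0%R.
  case: j => // j jk; have [//||->|->] := p12 j.+1; by rewrite ?p1 ?addr0.
apply: (prefix_sum_eq0 fK) => j; rewrite leq_eqVlt ltnS => /predU1P [->|]; last exact: pk.
have segk : seg f k k.+1 = [set b] by rewrite -(seg1 fK b) f_apex.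
have := coord_sum_seg f u (leqnSn k); rewrite segk coord_sum1.
rewrite -/(p k) (pk k) // subr0 => <-.
by move: b1; rewrite p1 addr0.
Qed.

(** The choice of block depends on which of b + p_1, b and p_1 vanish on the flat. In each case a
    second vanishing form in the chosen block yields, by adding or subtracting, a form already
    excluded. *)
Lemma delta_singleton_block (B : {set {set 'I_k.+1}})
    (z := fun s i j => (flat B <= hyp (delta_set s i j))%MS) :
  (exists s i j, delta_valid s i j && z s i j) ->
  exists s i j, [/\ delta_valid s i j, z s i j & forall s' i' j', delta_valid s' i' j' ->
    delta_label s' i' j' = delta_label s i j -> z s' i' j' ->
    delta_set s' i' j' = delta_set s i j].
Proof.
move=> [t [a [c /andP [v0 z0]]]].
pose val (s : bool) i j (u : 'rV[rat]_k.+1) :=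
  ((if s then u 0 b else 0) + prefix_sum f u j - prefix_sum f u i)%R.
have zP s i j : i <= j <= k ->
    reflect (forall u, (u <= flat B)%MS -> val s i j u = 0%R) (z s i j).
  move=> ijk; apply: (iffP (flat_sub_hypP B (delta_set s i j))) => H u uB.
    by rewrite /val -coord_sum_delta_set // H.
  by rewrite coord_sum_delta_set // -/(val s i j u) H.
(* The implications below are instances: each conclusion is a linear combination of the two forms
   assumed to vanish, with the coefficients supplied. *)
have comb2 s i j s1 i1 j1 s2 i2 j2 (c1 c2 : rat) :
    i <= j <= k -> i1 <= j1 <= k -> i2 <= j2 <= k ->
    (forall u, val s i j u = c1 * val s1 i1 j1 u + c2 * val s2 i2 j2 u)%R ->
    z s1 i1 j1 -> z s2 i2 j2 -> z s i j.
  move=> b0 b1 b2 E /(zP _ _ _ b1) H1 /(zP _ _ _ b2) H2; apply/(zP _ _ _ b0) => u uB.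
  by rewrite E H1 // H2 // !mulr0 addr0.
have p0 := prefix_sum0 f.
have two i i' j : i <= i' <= j -> j <= k -> z false i j -> z false i' j -> z false i i'.
  move=> ii jk; apply: (@comb2 _ _ _ _ _ _ _ _ _ 1%R (-1)%R); try (by clear -ii jk; lia).
  by move=> u; rewrite /val /=; lra.
have segT i j : i <= j <= k -> z false i j -> z true 0 j -> z true 0 i.
  move=> ij; apply: (@comb2 _ _ _ _ _ _ _ _ _ (-1)%R 1%R); try (by clear -ij; lia).
  by move=> u; rewrite /val /=; lra.
have segT1 i j : 0 < i <= j -> j <= k -> z false i j -> z true 1 j -> z true 1 i.
  move=> ij jk; apply: (@comb2 _ _ _ _ _ _ _ _ _ (-1)%R 1%R); try (by clear -ij jk; lia).
  by move=> u; rewrite /val /=; lra.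
have TT1 j : 0 < j <= k -> z true 0 j -> z true 1 j -> z false 0 1.
  move=> ij; apply: (@comb2 _ _ _ _ _ _ _ _ _ 1%R (-1)%R); try (by clear -ij; lia).
  by move=> u; rewrite /val /=; lra.
have apex_0 : z true 1 1 -> z true 0 0.
  move=> h; apply: (@comb2 _ _ _ _ _ _ _ _ _ 1%R 0%R _ _ _ _ h h); try (by clear -k2; lia).
  by move=> u; rewrite /val /=; lra.
have apexT j : j <= k -> z true 0 0 -> z false 0 j -> z true 0 j.
  move=> jk; apply: (@comb2 _ _ _ _ _ _ _ _ _ 1%R 1%R); try (by clear -jk; lia).
  by move=> u; rewrite /val /= !p0; lra.
have apexTV j : j <= k -> z true 0 j -> z false 0 j -> z true 0 0.
  move=> jk; apply: (@comb2 _ _ _ _ _ _ _ _ _ 1%R (-1)%R); try (by clear -jk; lia).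
  by move=> u; rewrite /val /= !p0; lra.
have apexT1 j : 0 < j <= k -> z true 1 j -> z true 0 0 -> z false 1 j.
  move=> jk; apply: (@comb2 _ _ _ _ _ _ _ _ _ 1%R (-1)%R); try (by clear -jk; lia).
  by move=> u; rewrite /val /= !p0; lra.
have T1apex j : 0 < j <= k -> z true 1 j -> z false 1 j -> z true 0 0.
  move=> jk; apply: (@comb2 _ _ _ _ _ _ _ _ _ 1%R (-1)%R); try (by clear -jk; lia).
  by move=> u; rewrite /val /= !p0; lra.
have join i j : i <= j <= k -> z false 0 i -> z false 0 j -> z false i j.
  move=> ij; apply: (@comb2 _ _ _ _ _ _ _ _ _ (-1)%R 1%R); try (by clear -ij; lia).
  by move=> u; rewrite /val /= !p0; lra.
have unjoin i j : i <= j <= k -> z false i j -> z false 0 j -> z false 0 i.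
  move=> ij; apply: (@comb2 _ _ _ _ _ _ _ _ _ (-1)%R 1%R); try (by clear -ij; lia).
  by move=> u; rewrite /val /= !p0; lra.
(* The form b + p_1 is the only member of block 1. *)
have [z1|nz1] := boolP (z true 0 1).
  exists true, 0, 1; split=> //; first by rewrite /delta_valid; clear -k2; lia.
  move=> [] i j; rewrite /delta_valid /delta_label => v l _.
    have [-> ->] : i = 0 /\ j = 1 by clear -v l; lia.
    by [].
  by exfalso; move: v l; clear; case: eqP; lia.
have not_both : z true 0 0 -> z false 0 1 -> False.
  by move=> zb z01; move/negP: nz1; apply; apply: apexT => //; apply: ltnW.
have validT i j : delta_valid true i j -> 0 < j -> (i = 0 \/ i = 1) /\ i < j <= k.
  by rewrite /delta_valid; clear; lia.
have labelF i j l : delta_label false i j = l -> 0 < l -> 0 < i /\ j = l.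
  by rewrite /delta_label; clear; case: eqP; lia.
have label0 i j : delta_valid false i j -> delta_label false i j = 0 -> i = 0 /\ 0 < j <= k.
  by rewrite /delta_valid /delta_label; clear; case: eqP; lia.
have validT0 i : delta_valid true i 0 -> i = 0.
  by rewrite /delta_valid; clear; lia.
(* Only one of b and p_1 can vanish now, since their sum does not. If further p_j vanish, take the
   least j > 1: block j then meets the flat only in b + p_j if b vanishes, and only in p_j - p_1 if
   p_1 does. If there is no such j, block 0 meets it in b or p_1 alone. *)
have [zA|] := boolP (z true 0 0 || z false 0 1).
  have [[j [jk /andP [j2 zj] jmin]]|none] := min_or_none (fun j => (1 < j) && z false 0 j) k.
    have low i : 1 < i < j -> z false 0 i -> False.
      by move=> /andP [i1 ij] zi; have := jmin i ij; rewrite i1 zi.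
    have j0 : 0 < j by apply: ltnW.
    case/orP: zA => [zb|z01].
      exists true, 0, j; split; [|exact: apexT|].
        by rewrite /delta_valid; clear -j2 jk; lia.
      move=> [] i j' v l z'.
        move: l v z' => /= -> v; have [[->|->] _] := validT i j v j0; first by [].
        move=> zT1; case: (not_both zb); apply: (unjoin 1 j); rewrite ?jk ?andbT //.
        by apply: apexT1; rewrite ?j0.
      have [i_gt j'E] := labelF i j' j l j0; rewrite j'E in v z'.
      move: v; rewrite /delta_valid => /andP [ij _].
      have z0i : z false 0 i by apply: unjoin z' zj; rewrite (ltnW ij).
      have [i1|i1] := eqVneq i 1; first by case: (not_both zb); rewrite -i1.
      by case: (low i) => //; clear -i_gt i1 ij; lia.
    have z1j : z false 1 j by apply: join; rewrite ?j0.
    exists false, 1, j; split=> //; first by rewrite /delta_valid j2.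
    move=> [] i j' v l z'.
      move: l v z' => /= -> v; have [[->|->] _] := validT i j v j0 => z'.
        by case: not_both; first exact: apexTV z' zj.
      by case: not_both; first by apply: T1apex z' z1j; rewrite j0.
    have [i_gt j'E] := labelF i j' j l j0; rewrite j'E in v z' *.
    move: v; rewrite /delta_valid => /andP [ij _].
    have z0i : z false 0 i by apply: unjoin z' zj; rewrite (ltnW ij).
    have [-> //|i1] := eqVneq i 1.
    by case: (low i) => //; clear -i_gt i1 ij; lia.
  have only1 j : 0 < j <= k -> z false 0 j -> j = 1.
    move=> /andP [j0 jk] zj; have := none j jk; rewrite zj andbT; clear -j0; lia.
  case/orP: zA => [zb|z01].
    exists true, 0, 0; split=> //.
    move=> [] i j v l z'; first by move: l v => /= -> /validT0 ->.
    have [iE jk] := label0 _ _ v l; rewrite iE in z'.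
    by case: (not_both zb); rewrite -(only1 j jk).
  exists false, 0, 1; split=> //; first by rewrite /delta_valid; clear -k2; lia.
  move=> [] i j v l z'.
    by move: l v z' => /= -> /validT0 -> zb; case: (not_both zb).
  have [iE jk] := label0 _ _ v l; rewrite iE in z' *.
  by rewrite (only1 j jk z').
rewrite negb_or => /andP [nzb nz01].
(* None of b, p_1 and b + p_1 vanishes, and [W j] says that block [j], with j > 1, has a vanishing
   form. At the least such [j], two of them would produce a vanishing form in some block i with 1 <
   i < j, or one of the three excluded forms. *)
pose W j := (1 < j) && [|| has (fun i => z false i j) (iota 1 j.-1), z true 0 j | z true 1 j].
have W_seg i j : 0 < i < j -> z false i j -> W j.
  move=> ij zij; rewrite /W; have -> : has (fun i => z false i j) (iota 1 j.-1).
    by apply/hasP; exists i => //; rewrite mem_iota; clear -ij; lia.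
  by rewrite andbT; clear -ij; lia.
have W_T0 j : 1 < j -> z true 0 j -> W j by rewrite /W => -> ->; rewrite orbT.
have W_T1 j : 1 < j -> z true 1 j -> W j by rewrite /W => -> ->; rewrite !orbT.
have [[j [jk Wj jmin]]|none] := min_or_none W k.
  have low i : i < j -> W i -> False by move=> ij; apply/negP/jmin.
  have j2 : 1 < j by case/andP: Wj.
  have j0 : 0 < j by apply: ltnW.
  have ge2 i : 0 < i -> i != 1 -> 1 < i by clear; lia.
  have FF i i' : 0 < i < i' -> i' < j -> z false i j -> z false i' j -> False.
    move=> ii ij' zi zi'; apply: (low i' ij'); apply: (W_seg i) => //.
    by apply: (two i i' j) => //; clear -ii ij'; lia.
  have FT0 i : 0 < i < j -> z false i j -> z true 0 j -> False.
    move=> ij zi zT; have zTi : z true 0 i by apply: segT zi zT; clear -ij jk; lia.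
    have [i1|i1] := eqVneq i 1; first by move: nz1; rewrite -i1 zTi.
    by case/andP: ij => i0' ij; apply: (low i ij); apply: W_T0 => //; apply: ge2.
  have FT1 i : 0 < i < j -> z false i j -> z true 1 j -> False.
    move=> ij zi zT; have zTi : z true 1 i by apply: segT1 zi zT => //; clear -ij jk; lia.
    have [i1|i1] := eqVneq i 1; first by move: nzb; rewrite apex_0 // -{2}i1.
    by case/andP: ij => i0' ij; apply: (low i ij); apply: W_T1 => //; apply: ge2.
  have T01 : z true 0 j -> z true 1 j -> False.
    by move=> h1 h2; move/negP: nz01; apply; apply: TT1 h1 h2; rewrite j0.
  case/andP: Wj => _ /or3P [/hasP [i]|zT0|zT1].
  - rewrite mem_iota => ij' zi; have ij : 0 < i < j by clear -ij' j2; lia.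
    exists false, i, j; split=> //; first by rewrite /delta_valid jk; case/andP: ij => _ ->.
    have lE : delta_label false i j = j by rewrite /delta_label; clear -ij; case: eqP; lia.
    rewrite lE => -[] i' j' v l z'.
      move: l v z' => /= -> v; have [[->|->] _] := validT i' j v j0 => z'.
        by case: (FT0 i).
      by case: (FT1 i).
    have [i_gt j'E] := labelF i' j' j l j0; rewrite j'E in v z' *.
    move: v; rewrite /delta_valid => /andP [i'j _].
    case/andP: ij => i_pos ij.
    have [ii|ii|-> //] := ltngtP i i'.
      by case: (FF i i') => //; rewrite i_pos.
    by case: (FF i' i) => //; rewrite i_gt.
  - exists true, 0, j; split=> //; first by rewrite /delta_valid; clear -j0 jk; lia.
    move=> [] i' j' v l z'.
      move: l v z' => /= -> v; have [[->|->] _] := validT i' j v j0 => z' //.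
      by case: T01.
    have [i_gt j'E] := labelF i' j' j l j0; rewrite j'E in v z' *.
    by case: (FT0 i') => //; move: v; rewrite /delta_valid i_gt => /andP [].
  - exists true, 1, j; split=> //; first by rewrite /delta_valid; clear -j2 jk; lia.
    move=> [] i' j' v l z'.
      move: l v z' => /= -> v; have [[->|->] _] := validT i' j v j0 => z' //.
      by case: T01.
    have [i_gt j'E] := labelF i' j' j l j0; rewrite j'E in v z' *.
    by case: (FT1 i') => //; move: v; rewrite /delta_valid i_gt => /andP [].
(* Only block 0 can have a vanishing form now, and it is not b but some p_c. A second one p_j would
   make the difference of the two vanish, which lies in a block excluded by [noW]. *)
have noW j : j <= k -> W j -> False by move=> jk; apply/negP/none.
case: t v0 z0 => v0 z0.
  have [c0|c_pos] := posnP c.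
    by move: v0 z0 nzb; rewrite c0 => /validT0 -> ->.
  have [[iE|iE] /andP [ij jk]] := validT _ _ v0 c_pos; rewrite iE in z0 ij.
    have [j1|j1] := eqVneq c 1; first by move: nz1; rewrite -j1 z0.
    by case: (noW c) => //; apply: W_T0 => //; clear -c_pos j1; lia.
  by case: (noW c) => //; apply: W_T1.
have /andP [ij jk] : a < c <= k by [].
have [a0|i_pos] := posnP a; last by case: (noW c) => //; apply: W_seg z0; rewrite i_pos.
rewrite a0 in v0 z0 ij.
have ne1 j : z false 0 j -> j != 1 by apply: contraTneq => ->.
exists false, 0, c; split=> //; rewrite {2}/delta_label /=.
move=> [] i j v l z'; first by move: l v z' => /= -> /validT0 ->; rewrite (negPf nzb).
have [iE /andP [j_pos jk']] := label0 _ _ v l; rewrite iE in z' *.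
have [jj|jj|-> //] := ltngtP j c.
  case: (noW c) => //; apply: (W_seg j); first by rewrite j_pos.
  by apply: join => //; rewrite (ltnW jj).
case: (noW j) => //; apply: (W_seg c); first by rewrite ij.
by apply: join => //; rewrite (ltnW jj).
Qed.

Lemma delta_factored_aux : factored (CSA e).
Proof.
apply: (@factored_of_codes _ _ delta_valid delta_set delta_label).
- move=> s i j; rewrite /delta_valid /delta_label; clear.
  by case: s; [split; lia|case: eqP; split; lia].
- exact: delta_label_set.
- exact: connected_delta_set.
- exact: delta_transversal_spans.
- exact: delta_singleton_block.
Qed.

End DeltaFactored.

Lemma delta_factored n (e : rel 'I_n) k : symmetric e -> 1 < k -> n = k.+1 ->
  graph_iso e (@delta_rel n) -> factored (CSA e).
Proof.
move=> e_sym k2 nk; subst n => -[f [[g fK gK] e_f]].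
exact: (delta_factored_aux k2 e_sym fK gK).
Qed.

Theorem theorem8p10 (n : nat) (e : rel 'I_n)
    (e_sym : symmetric e) (e_irr : irreflexive e) (e_conn : connected_graph e) :
  factored (CSA e) <->
  (graph_iso e (@path_rel n) \/
   (exists k : nat, 2 <= k /\ n = k.+1 /\ graph_iso e (@delta_rel n))).
Proof.
split=> [facA|[|[k [k2 [nk]]]]].
- have [[f emb]|[k [f [k2 nk emb]]]] := factored_embeds e_sym e_irr facA e_conn.
    by left; apply: embeds_graph_iso emb.
  have kE : k = n.-1 by rewrite nk.
  by right; exists k; do 2!split=> //; rewrite kE in emb; exact: embeds_graph_iso emb.
- exact: (path_factored e_sym).
- exact: (delta_factored e_sym k2 nk).
Qed.
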